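(* Let $n\ge1$ and let $x=(x_1,\dots,x_{2n})$ be indeterminates. Then \begin{align*} A^{(2)}_{\mathrm{VO}}(8n+3;x;\zeta_4)&=2^{-4n^2+2n}\prod_{i=1}^{2n}x_i^{-4n+2}\prod_{1\le i<j\le2n}(x_j^2+x_i^2)(1+x_i^2x_j^2),\\ A^{(2)}_{\mathrm{VO}}(8n+3;x;\zeta_6)&=3^{-2n^2+n}\,\mathrm{Sp}_{4n}\big(\delta(n-1,n-1);x_1^2,\dots,x_{2n}^2\big)\,\mathrm{Sp}_{4n+2}\big(\delta(n,n-1);x_1^2,\dots,x_{2n}^2,1\big). \end{align*}
   Context: $\sigma(t)=t-t^{-1}$, $\zeta_m=\exp(2\pi\sqrt{-1}/m)$. For parameters $a,c$ let $M^{(2)}_{\mathrm{UO}}(n;x;a,c)$ be the skew-symmetric $2n\times2n$ matrix with entries $\sigma(x_j/x_i)\sigma(x_ix_j)\Big(\dfrac{\sigma(cx_i)\sigma(cx_j)}{\sigma(ax_ix_j)}-\dfrac{\sigma(cx_i)\sigma(c/x_j)}{\sigma(ax_i/x_j)}-\dfrac{\sigma(c/x_i)\sigma(cx_j)}{\sigma(ax_j/x_i)}+\dfrac{\sigma(c/x_i)\sigma(c/x_j)}{\sigma(a/(x_ix_j))}\Big)$, let $F_{\mathrm{UO}}(n;x;a)=\dfrac{\prod_{1\le i<j\le2n}\sigma(ax_i/x_j)\sigma(ax_j/x_i)\sigma(ax_ix_j)\sigma(a/(x_ix_j))}{\prod_{1\le i<j\le2n}\sigma(x_j/x_i)\prod_{1\le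 i\le j\le2n}\sigma(x_ix_j)}$, and $A^{(2)}_{\mathrm{VO}}(8n+3;x;a)=\sigma(a)^{-4n^2+n}F_{\mathrm{UO}}(n;x;a)\operatorname{Pf}M^{(2)}_{\mathrm{UO}}(n;x;a,a^{-1})$. For $r\in\mathbb Z$, $\delta(r)=(r,r-1,\dots)$ consists of all $r-k\ge0$ ($k\in\mathbb Z_{\ge0}$), empty if $r<0$; $\delta(r,s)$ arranges the entries of $\delta(r),\delta(s)$ together in non-increasing order (here $\delta(n-1,n-1)$ has $2n$ entries and $\delta(n,n-1)$ has $2n+1$ entries). For a partition $\lambda$ of length $\le N$ and $z=(z_1,\dots,z_N)$, $\mathrm{Sp}_{2N}(\lambda;z)=\det\big(z_i^{\lambda_j+N-j+1}-z_i^{-(\lambda_j+N-j+1)}\big)/\det\big(z_i^{N-j+1}-z_i^{-(N-j+1)}\big)$, a symmetric Laurent polynomial; setting a variable equal to $1$ means evaluating this Laurent polynomial. *)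

(* Defs.v *)
From HB Require Import structures.
From mathcomp Require Import all_boot all_order all_algebra perm.
From mathcomp Require Import fraction complex mpoly.
From mathcomp Require Import boolp classical_sets reals trigo.

Set Implicit Arguments.
Unset Strict Implicit.
Unset Printing Implicit Defensive.

Import Order.TTheory GRing.Theory Num.Theory.

Local Open Scope ring_scope.

Definition zeta (R : realType) (m : nat) : R[i] :=
  (cos (2%:R * pi / m%:R) +i* sin (2%:R * pi / m%:R))%C.

Definition sigma (F : fieldType) (t : F) : F := t - t^-1.

(* Pfaffian, indices starting at 0; dividing by 2 ^ n * n! requires
   characteristic 0. *)
Lemma pf_even_subproof (n : nat) (i : 'I_n) : (2 * i < 2 * n)%N.
Proof. by rewrite ltn_pmul2l. Qed.

Lemma pf_odd_subproof (n : nat) (i : 'I_n) : ((2 * i).+1 < 2 * n)%N.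
Proof. by rewrite -add2n -mulnS leq_pmul2l. Qed.

Definition pf_even (n : nat) (i : 'I_n) : 'I_(2 * n) :=
  Ordinal (pf_even_subproof i).
Definition pf_odd (n : nat) (i : 'I_n) : 'I_(2 * n) :=
  Ordinal (pf_odd_subproof i).

Definition Pf (F : fieldType) (n : nat) (M : 'M[F]_(2 * n)) : F :=
  ((2 ^ n * n`!)%N%:R)^-1 *
  \sum_(s : 'S_(2 * n)) (-1) ^+ s * \prod_(i < n) M (s (pf_even i)) (s (pf_odd i)).

Section UO.
Variables (F : fieldType) (n : nat) (x : 'I_(2 * n) -> F).

Definition M2_UO (a c : F) : 'M[F]_(2 * n) :=
  \matrix_(i, j)
    (sigma (x j / x i) * sigma (x i * x j) *
     (sigma (c * x i) * sigma (c * x j) / sigma (a * x i * x j)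
      - sigma (c * x i) * sigma (c / x j) / sigma (a * x i / x j)
      - sigma (c / x i) * sigma (c * x j) / sigma (a * x j / x i)
      + sigma (c / x i) * sigma (c / x j) / sigma (a / (x i * x j)))).

Definition F_UO (a : F) : F :=
  (\prod_(i < 2 * n) \prod_(j < 2 * n | (i < j)%N)
     (sigma (a * x i / x j) * sigma (a * x j / x i) *
      sigma (a * x i * x j) * sigma (a / (x i * x j)))) /
  ((\prod_(i < 2 * n) \prod_(j < 2 * n | (i < j)%N) sigma (x j / x i)) *
   (\prod_(i < 2 * n) \prod_(j < 2 * n | (i <= j)%N) sigma (x i * x j))).

(* A2_VO n x a is the function written A_VO^(2)(8n+3; x; a). *)
Definition A2_VO (a : F) : F :=
  sigma a ^ (- (4 * n%:Z ^+ 2) + n%:Z) * F_UO a * Pf (M2_UO a a^-1).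

End UO.

Arguments A2_VO {F} n x a.

Definition delta (r : int) : seq nat :=
  if r is Posz m then rev (iota 0 m.+1) else [::].

Definition delta2 (r s : int) : seq nat := sort geq (delta r ++ delta s).

(* Laurent polynomials in N variables over the integers are the fractions of
   the form p / (X_0 ... X_(N-1)) ^ k with p a polynomial. They can be evaluated
   at any point with nonzero coordinates, also where the expression as a
   quotient of determinants degenerates to 0 / 0. The pair (p, k) is not unique,
   but the value at such a point does not depend on it. *)
Definition laurent_rep (N : nat) (f : {fraction {mpoly int[N]}}) :
    {mpoly int[N]} * nat :=
  xget (0, 0%N)
    [set pk | f = tofrac pk.1 / tofrac (\prod_(i < N) 'X_i) ^+ pk.2]%classic.

Definition laurent_eval (N : nat) (F : fieldType)
    (f : {fraction {mpoly int[N]}}) (v : 'I_N -> F) : F :=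
  let: (p, k) := laurent_rep f in
  mmap (intmul 1) v p / (\prod_(i < N) v i) ^+ k.

(* The bialternant with exponents lambda_j + N - j + 1, which become
   lam`_j + (N - j) as indices here start at 0. *)
Definition sp_alternant (N : nat) (lam : seq nat) : {fraction {mpoly int[N]}} :=
  \det (\matrix_(i < N, j < N)
          let z : {fraction {mpoly int[N]}} := tofrac 'X_i in
          let e := (nth 0%N lam j + (N - j))%N in
          z ^+ e - z ^- e).

(* Sp N lam z is Sp_{2N}(lam; z). *)
Definition Sp (N : nat) (F : fieldType) (lam : seq nat) (v : 'I_N -> F) : F :=
  laurent_eval (sp_alternant N lam / sp_alternant N [::]) v.

Arguments Sp N {F} lam v.

(* (v_0, ..., v_(N-1), c) *)
Definition rcons_fun (N : nat) (T : Type) (v : 'I_N -> T) (c : T)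
    (i : 'I_N.+1) : T :=
  if unlift ord_max i is Some j then v j else c.

Definition ratfun (R : realType) (N : nat) : fieldType :=
  {fraction {mpoly R[i][N]}}.

Definition ratC (R : realType) (N : nat) (c : R[i]) : ratfun R N :=
  tofrac (mpolyC N c).

Definition ratX (R : realType) (N : nat) (i : 'I_N) : ratfun R N :=
  tofrac 'X_i.
Arguments ratX R {N} i.

(* Main.v *)
(** Write [z i = x i ^+ 2 + x i ^- 2]. For [a = zeta 4] and [a = zeta 6] the
    entries of [M2_UO] are, up to factors attached to rows and columns, of the
    form [(b j - b i) * (c j - c i) / (y j - y i)], with [y = z ^+ 2], [b = c = z]
    in the first case and [y = z ^+ 3 - 3 * z], [b = z], [c = (z + 1) ^+ 2] in the
    second. The Pfaffian of such a matrix is [D b * D c] divided by the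
    Vandermonde product of [y], where [D b] is the determinant with columns
    [1, b, y, y * b, y ^+ 2, ...]: as functions of [y 0] both the expansion of the
    Pfaffian along the first row and the product [D b * D c] are given by Lagrange
    interpolation at the other [y j]. For [zeta 4] the determinants are
    Vandermonde determinants. For [zeta 6], dividing the rows of the symplectic
    bialternants by [x i ^+ 2 - x i ^- 2] gives Chebyshev polynomials in [z i] of
    degrees [0, 1, 3, 4, 6, 7, ...], and column operations turn them into the
    columns of [D z]. In the bialternant with one variable equal to [1], where
    [z = 2], further column operations make the last row [(1, 0, ..., 0)] and the
    remaining minor is a multiple of [D ((z + 1) ^+ 2)]. *)
Require Import Defs.
From HB Require Import structures.
From mathcomp Require Import all_boot all_order all_algebra perm.
From mathcomp Require Import fraction complex mpoly.
From mathcomp Require Import boolp classical_sets reals trigo.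
From mathcomp Require Import ring lra zify.
Set Implicit Arguments.
Unset Strict Implicit.
Unset Printing Implicit Defensive.
Import Order.TTheory GRing.Theory Num.Theory.
Local Open Scope ring_scope.

(** * Determinants under column operations and row scaling *)

(** The columns [g j] are the columns [h j] times a unitriangular matrix, whose determinant is 1. *)
Lemma det_unitriangular (R : comNzRingType) (N : nat) (g h : nat -> 'I_N -> R) :
  (forall j, (j < N)%N ->
     exists c : nat -> R, forall i, g j i = h j i + \sum_(l < j) c l * h l i) ->
  \det (\matrix_(i, j) g j i) = \det (\matrix_(i, j) h j i).
Proof.
move=> gh.
have {}gh (j : 'I_N) : exists c : nat -> R,
    forall i, g j i = h j i + \sum_(l < j) c l * h l i by exact: gh.
have [c gE] := boolp.choice gh.
pose C : 'M[R]_N :=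
  \matrix_(j, l) (if (l < j)%N then c j l else (l == j)%:R).
have -> : \matrix_(i, j) g j i = (\matrix_(i, j) h j i) *m C^T.
  apply/matrixP => i j; rewrite !mxE gE.
  rewrite (bigID (fun l : 'I_N => (l < j)%N)) /= addrC; congr (_ + _).
    rewrite (bigD1 j) ?ltnn //= !mxE ltnn eqxx mulr1 big1 ?addr0 // => l.
    by case/andP => lj nlj; rewrite !mxE (negPf lj) (negPf nlj) mulr0.
  rewrite (big_ord_widen N (fun l => c j l * h l i)); last exact: ltnW.
  by apply: eq_bigr => l lj; rewrite !mxE lj mulrC.
rewrite det_mulmx det_tr (_ : \det C = 1) ?mulr1 // det_trig.
  by rewrite big1 // => i _; rewrite !mxE ltnn eqxx.
apply/is_trig_mxP => i j ij; rewrite !mxE ltnNge (ltnW ij) /=.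
by rewrite -val_eqE /= gtn_eqF.
Qed.

Lemma det_scale_rows (R : comNzRingType) (N : nat) (r : 'I_N -> R) (A : 'M[R]_N) :
  \det (\matrix_(i, j) (r i * A i j)) = (\prod_i r i) * \det A.
Proof.
have -> : \matrix_(i, j) (r i * A i j) = diag_mx (\row_i r i) *m A.
  by apply/matrixP => i j; rewrite mul_diag_mx !mxE.
by rewrite det_mulmx det_diag; under eq_bigr do rewrite mxE.
Qed.

(** * Interlaced and Vandermonde determinants *)

(** Its determinant is the [D a] of the overview. The sequences are indexed by [nat], so that rows
    can be shifted by [\o S] or relabelled without changing types. *)
Definition interlaced (R : nzRingType) (N : nat) (y a : nat -> R) : 'M[R]_N :=
  \matrix_(i, k) (y i ^+ k./2 * a i ^+ odd k).

Definition vdm (R : nzRingType) (N : nat) (y : nat -> R) : R :=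
  \prod_(i < N) \prod_(j < N | (i < j)%N) (y j - y i).

Lemma vdmE (R : comNzRingType) (N : nat) (y : nat -> R) :
  vdm N y = \det (\matrix_(i < N, j < N) y i ^+ j).
Proof.
rewrite -det_tr -[RHS](_ : \det (Vandermonde N (\row_(i < N) y i)) = _).
  by rewrite det_Vandermonde; do 2!apply: eq_bigr => ? _; rewrite !mxE.
by congr (\det _); apply/matrixP => i j; rewrite !mxE.
Qed.

Lemma vdm_recl (R : comNzRingType) (N : nat) (y : nat -> R) :
  vdm N.+1 y = \prod_(i < N) (y i.+1 - y 0%N) * vdm N (y \o S).
Proof.
rewrite /vdm big_ord_recl big_mkcond big_ord_recl /= mul1r.
congr (_ * _); apply: eq_bigr => i _.
by rewrite big_mkcond big_ord_recl /= mul1r -big_mkcond.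
Qed.

Lemma vdm_neq0 (F : fieldType) (N : nat) (y : nat -> F) :
  {in gtn N &, injective y} -> vdm N y != 0.
Proof.
move=> yI; apply/prodf_neq0 => i _; apply/prodf_neq0 => j ij.
rewrite subr_eq0; apply/eqP => /yI e; move: ij.
by rewrite e ?ltnn // inE.
Qed.

(** Subtracting [y 1] times column [k] from column [k + 2] clears the first two rows outside the
    first two columns, since [y] takes the same value on both rows. The matrix becomes block
    triangular, and every later row of the lower block carries a factor [y i.+2 - y 1]. *)
Lemma det_interlaced_eq01 (R : comNzRingType) (M : nat) (y a : nat -> R) :
  y 0%N = y 1%N ->
  \det (interlaced M.+2 y a) =
  (a 1%N - a 0%N) * \prod_(i < M) (y i.+2 - y 1%N) *
  \det (interlaced M (y \o S \o S) (a \o S \o S)).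
Proof.
move=> y01.
pose h (k : nat) (i : 'I_M.+2) := y i ^+ k./2 * a i ^+ odd k.
pose g (k : nat) (i : 'I_M.+2) :=
  if k is k'.+2 then h k i - y 1%N * h k' i else h k i.
have -> : \det (interlaced M.+2 y a) = \det (\matrix_(i, k) g k i).
  symmetry; apply: (@det_unitriangular _ _ g h) => -[|[|k]] kN.
  - by exists (fun=> 0) => i; rewrite big_ord0 addr0.
  - by exists (fun=> 0) => i; rewrite big1 ?addr0 // => l _; rewrite mul0r.
  exists (fun l => if l == k then - y 1%N else 0) => i.
  rewrite /g; congr (_ + _).
  rewrite (bigD1 (Ordinal (leqnSn k.+1))) //= eqxx mulNr big1 ?addr0 // => l.
  by rewrite -val_eqE /= => /negPf ->; rewrite mul0r.
pose G : 'M[R]_(2 + M) := \matrix_(i, k) g k i.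
have G0 : ursubmx G = 0.
  apply/matrixP => i j; rewrite !mxE /g /h /= negbK exprS -!mulrA.
  have -> : y (i : nat) = y 1%N by case: i => -[|[|]].
  by rewrite subrr.
rewrite -[LHS]/(\det G) -[in LHS](submxK G) G0 det_lblock -mulrA.
rewrite -(det_scale_rows (fun i : 'I_M => y i.+2 - y 1%N)); congr (_ * _).
  rewrite (expand_det_row _ ord0) !big_ord_recl big_ord0 /cofactor !det_mx11.
  by rewrite !mxE /= /g /h /= /bump /=; ring.
congr (\det _); apply/matrixP => i j; rewrite !mxE /g /h /= negbK exprS.
by rewrite mulrBl !mulrA.
Qed.

(** * Relabelling of indices and antisymmetrization *)

(** Numbers from [N] on are fixed, so a permutation acts on sequences indexed by [nat] by
    composition. *)
Definition extend_perm (N : nat) (s : 'S_N) (k : nat) : nat :=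
  if insub k is Some i then val (s i) else k.

Lemma extend_permE (N : nat) (s : 'S_N) (i : 'I_N) : extend_perm s i = s i.
Proof. by rewrite /extend_perm valK. Qed.

Lemma extend_permM (N : nat) (c s : 'S_N) :
  extend_perm s \o extend_perm c = extend_perm (c * s)%g.
Proof.
apply/funext => k; rewrite /= /extend_perm.
by case: (@insubP _ _ 'I_N k) => [i _ _|Nk]; [rewrite valK permM | rewrite insubN].
Qed.

Lemma extend_perm_tperm (N : nat) (i j : 'I_N) (k : nat) :
  extend_perm (tperm i j) k =
  if k == i then j : nat else if k == j then i : nat else k.
Proof.
rewrite /extend_perm; case: insubP => [l _ <-|].
  by rewrite permE /= -!val_eqE; case: ifP => // _; case: ifP.
rewrite -leqNgt => Nk.
by rewrite !gtn_eqF // (leq_trans (ltn_ord _)).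
Qed.

Lemma extend_perm_inj (N : nat) (s : 'S_N) :
  {in gtn N &, injective (extend_perm s)}.
Proof.
move=> i j; rewrite !inE => iN jN.
by rewrite (extend_permE s (Ordinal iN)) (extend_permE s (Ordinal jN))
  => /val_inj/perm_inj[->].
Qed.

Lemma extend_perm_lt (N : nat) (s : 'S_N) (k : nat) :
  (k < N)%N -> (extend_perm s k < N)%N.
Proof. by move=> kN; rewrite (extend_permE s (Ordinal kN)). Qed.

Lemma det_interlaced_perm (R : comNzRingType) (N : nat) (s : 'S_N) (y a : nat -> R) :
  \det (interlaced N (y \o extend_perm s) (a \o extend_perm s)) =
  (-1) ^+ s * \det (interlaced N y a).
Proof.
rewrite -det_perm -det_mulmx -row_permE; congr (\det _).
by apply/matrixP => i k; rewrite !mxE /= extend_permE.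
Qed.

Lemma vdm_perm (R : comNzRingType) (N : nat) (s : 'S_N) (y : nat -> R) :
  vdm N (y \o extend_perm s) = (-1) ^+ s * vdm N y.
Proof.
rewrite !vdmE -det_perm -det_mulmx -row_permE; congr (\det _).
by apply/matrixP => i k; rewrite !mxE /= extend_permE.
Qed.

(** Antisymmetrization of a function of the index map [r]. The sum in [Pf] is the case [r = id]; the
    induction on the size needs other index maps. *)
Definition alternate (R : nzRingType) (N : nat) (g : (nat -> nat) -> R)
    (r : nat -> nat) : R :=
  \sum_(s : 'S_N) (-1) ^+ s * g (r \o extend_perm s).

Lemma alternate_comp (R : comNzRingType) (N : nat) (g : (nat -> nat) -> R)
    (c : 'S_N) (r : nat -> nat) :
  alternate N (fun r' => g (r' \o extend_perm c)) r = (-1) ^+ c * alternate N g r.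
Proof.
rewrite /alternate mulr_sumr [RHS](reindex_inj (mulgI c)).
apply: eq_bigr => s _; rewrite -compA extend_permM mulrA odd_permM.
by rewrite signr_addb mulrA -signr_addb addbb mul1r.
Qed.

Lemma alternate_alternating (R : comNzRingType) (N : nat)
    (g : (nat -> nat) -> R) (r : nat -> nat) :
  (forall s : 'S_N, g (r \o extend_perm s) = (-1) ^+ s * g r) ->
  alternate N g r = N`!%:R * g r.
Proof.
move=> gE; rewrite /alternate (eq_bigr (fun=> g r)) => [|s _].
  by rewrite sumr_const card_Sn mulr_natl.
by rewrite gE mulrA -signr_addb addbb mul1r.
Qed.

(* The permutations of the last [M] positions form a subgroup of the
   permutations of all positions, so alternating the last positions first only
   multiplies the result by the order of the subgroup. *)
Lemma alternate_tail (R : comNzRingType) (M : nat) (g0 : nat -> nat -> R)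
    (g : (nat -> nat) -> R) (r : nat -> nat) :
  alternate M.+2
    (fun r => g0 (r 0%N) (r 1%N) * alternate M g (r \o S \o S)) r =
  M`!%:R * alternate M.+2 (fun r => g0 (r 0%N) (r 1%N) * g (r \o S \o S)) r.
Proof.
pose lift2 (s : 'S_M) : 'S_M.+2 := lift_perm ord0 ord0 (lift_perm ord0 ord0 s).
pose G r := g0 (r 0%N) (r 1%N) * g (r \o S \o S).
have lift2_sign s : (-1) ^+ lift2 s = (-1) ^+ s :> R.
  by rewrite /lift2 !odd_lift_perm.
have lift2_0 s : extend_perm (lift2 s) 0 = 0%N.
  by rewrite (extend_permE _ ord0) /lift2 lift_perm_id.
have lift2_1 s : extend_perm (lift2 s) 1 = 1%N.
  rewrite (extend_permE _ (lift ord0 ord0)).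
  by rewrite /lift2 lift_perm_lift lift_perm_id.
have lift2_S s r' : r' \o extend_perm (lift2 s) \o S \o S =
    r' \o S \o S \o extend_perm s.
  apply/funext => k /=; congr r'; have [kM|Mk] := ltnP k M; last first.
    by rewrite /extend_perm !insubN // -leqNgt.
  rewrite (extend_permE _ (Ordinal kM)).
  rewrite (extend_permE _ (lift ord0 (lift ord0 (Ordinal kM)))).
  by rewrite /lift2 !lift_perm_lift.
transitivity (\sum_(s : 'S_M) (-1) ^+ s *
    alternate M.+2 (fun r => G (r \o extend_perm (lift2 s))) r).
  rewrite /alternate (eq_bigr _ (fun s _ => mulr_sumr _ _ _ _)) exchange_big /=.
  apply: eq_bigr => t _; rewrite !mulr_sumr; apply: eq_bigr => s _.
  rewrite /G /= lift2_0 lift2_1; set h := _ \o extend_perm t.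
  rewrite -[X in g X]/(h \o S \o S \o extend_perm s) -lift2_S.
  by rewrite (mulrCA (g0 _ _)) (mulrCA ((-1) ^+ t)).
rewrite (eq_bigr (fun=> alternate M.+2 G r)) => [|s _].
  by rewrite sumr_const card_Sn mulr_natl.
by rewrite alternate_comp lift2_sign mulrA -signr_addb addbb mul1r.
Qed.

(** * The Pfaffian sum of the kernel and its closed form *)

Definition cauchy_kernel (F : fieldType) (y a b : nat -> F) (i j : nat) : F :=
  (a j - a i) * (b j - b i) / (y j - y i).

(** The closed form only; [Pf_cauchy_kernel] identifies it with a Pfaffian. *)
Definition cauchy_pfaffian (F : fieldType) (N : nat) (y a b : nat -> F) : F :=
  \det (interlaced N y a) * \det (interlaced N y b) / vdm N y.

Lemma cauchy_pfaffian_perm (F : fieldType) (N : nat) (s : 'S_N) (y a b : nat -> F) :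
  cauchy_pfaffian N (y \o extend_perm s) (a \o extend_perm s) (b \o extend_perm s) =
  (-1) ^+ s * cauchy_pfaffian N y a b.
Proof.
rewrite /cauchy_pfaffian !det_interlaced_perm vdm_perm invfM invr_sign.
rewrite [X in X * _ = _]mulrACA -signr_addb addbb mul1r.
by rewrite mulrCA.
Qed.

Lemma lagrange_interpolation (F : fieldType) (m : nat) (z : 'I_m -> F)
    (L : 'I_m -> {poly F}) (p : {poly F}) :
  injective z -> (size p <= m)%N -> (forall j, (size (L j) <= m)%N) ->
  (forall j l, (L j).[z l] = (l == j)%:R) -> p = \sum_j p.[z j] *: L j.
Proof.
move=> zI sp sL Lz; apply/eqP; rewrite -subr_eq0; apply/eqP.
apply: (@roots_geq_poly_eq0 _ _ [seq z j | j <- enum 'I_m]).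
- apply/allP => _ /mapP[l _ ->]; rewrite rootE hornerD hornerN horner_sum.
  rewrite (bigD1 l) //= hornerZ Lz eqxx mulr1 big1 ?addr0 ?subrr // => j jl.
  by rewrite hornerZ Lz eq_sym (negPf jl) mulr0.
- by rewrite map_inj_uniq ?enum_uniq.
rewrite size_map size_enum_ord (leq_trans (size_polyD _ _)) // geq_max sp size_polyN.
apply: leq_trans (size_sum _ _ _) _; apply/bigmax_leqP => j _.
by rewrite (leq_trans (size_scale_leq _ _)).
Qed.

(** Only row 0 depends on [t], as [a 0] stays fixed, so the expansion along that row is a polynomial
    whose exponents are the values [k./2]. *)
Lemma interlaced_row0_poly (R : comNzRingType) (N : nat) (y a : nat -> R) :
  exists2 q : {poly R}, (size q <= (N./2).+1)%N &
    forall t, q.[t] = \det (interlaced N.+1 (fun i => if i is 0 then t else y i) a).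
Proof.
exists (\sum_(k < N.+1)
    (a 0%N ^+ odd k * cofactor (interlaced N.+1 y a) ord0 k) *: 'X^(k./2)).
  apply: leq_trans (size_sum _ _ _) _; apply/bigmax_leqP => k _.
  rewrite (leq_trans (size_scale_leq _ _)) //.
  by rewrite size_polyXn ltnS half_leq // -ltnS.
move=> t; rewrite (expand_det_row _ ord0) horner_sum; apply: eq_bigr => k _.
rewrite hornerZ hornerXn !mxE mulrAC [a _ ^+ _ * _]mulrC; congr (_ * _ * _).
by congr (_ * \det _); apply/matrixP => i j; rewrite !mxE.
Qed.

(** Expansion along the first row. With [y 0] replaced by a variable, the product of the two
    determinants is a polynomial, recovered by Lagrange interpolation at the other [M.+1] values of
    [y]; at each of them [det_interlaced_eq01] factors both determinants. The index [j.+1] is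
    brought to position 1 by a transposition instead of a cycle, and the order of the remaining
    indices accounts for the sign. *)
Lemma cauchy_pfaffian_expand (F : fieldType) (M : nat) (y a b : nat -> F) :
  ~~ odd M -> {in gtn M.+2 &, injective y} ->
  cauchy_pfaffian M.+2 y a b =
  \sum_(j < M.+1)
    let c : 'S_M.+2 := tperm (lift ord0 ord0) (lift ord0 j) in
    (-1) ^+ c * (cauchy_kernel y a b 0 (extend_perm c 1) *
      cauchy_pfaffian M (y \o extend_perm c \o S \o S)
        (a \o extend_perm c \o S \o S) (b \o extend_perm c \o S \o S)).
Proof.
move=> oddM yI.
pose c (j : 'I_M.+1) : 'S_M.+2 := tperm (lift ord0 ord0) (lift ord0 j).
have cE j k : extend_perm (c j) k =
    if k == 1%N then j.+1 else if k == j.+1 then 1%N else k.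
  by rewrite extend_perm_tperm.
have c0 j : extend_perm (c j) 0 = 0%N by rewrite cE.
have c1 j : extend_perm (c j) 1 = j.+1 by rewrite cE.
have yN j k l : (k < M.+2)%N -> (l < M.+2)%N -> k != l ->
    y (extend_perm (c j) k) - y (extend_perm (c j) l) != 0.
  move=> kM lM; apply: contra_neq => /subr0_eq/yI e.
  by apply: (@extend_perm_inj _ (c j)) => //; apply: e; rewrite inE extend_perm_lt.
have yN1 j (i : 'I_M) : y (extend_perm (c j) i.+2) - y j.+1 != 0.
  by have := @yN j i.+2 1%N (ltn_ord i) isT isT; rewrite c1.
have yN0 j (i : 'I_M) : y (extend_perm (c j) i.+2) - y 0%N != 0.
  by have := @yN j i.+2 0%N (ltn_ord i) isT isT; rewrite c0.
have yN01 (j : 'I_M.+1) : y j.+1 - y 0%N != 0.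
  by have := @yN j 1%N 0%N isT isT isT; rewrite c0 c1.
pose upd t i := if i is 0 then t else y i.
(* The Lagrange basis: under the transposition [c j], the positions [i.+2] run through all nodes
   except [j.+1]. *)
pose L (j : 'I_M.+1) : {poly F} := \prod_(i < M)
  ((y (extend_perm (c j) i.+2) - y j.+1)^-1 *:
   ((y (extend_perm (c j) i.+2))%:P - 'X)).
have sL j : (size (L j) <= M.+1)%N.
  rewrite (leq_trans (size_prod_leq _ _)) // leq_subLR card_ord addnS ltnS.
  have -> : (M + M = \sum_(i < M) 2)%N by rewrite sum_nat_const card_ord muln2 addnn.
  apply: leq_sum => i _; rewrite (leq_trans (size_scale_leq _ _)) //.
  by rewrite -size_polyN opprB size_XsubC.
have LE j t : (L j).[t] = \prod_(i < M)
    ((y (extend_perm (c j) i.+2) - t) / (y (extend_perm (c j) i.+2) - y j.+1)).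
  rewrite horner_prod; apply: eq_bigr => i _.
  by rewrite hornerZ hornerD hornerN hornerX hornerC mulrC.
have Lz (j l : 'I_M.+1) : (L j).[y l.+1] = (l == j)%:R.
  rewrite LE; have [->|lj] := eqVneq l j.
    by rewrite big1 // => i _; rewrite divff ?yN1.
  have [i iE] : exists i : 'I_M, extend_perm (c j) i.+2 = l.+1.
    move: lj; case: l j => [[|l] lM] [[|j] jM] //= lj.
    - by exists (Ordinal (jM : (j < M)%N)); rewrite cE /= eqxx.
    - by exists (Ordinal (lM : (l < M)%N)); rewrite cE.
    by exists (Ordinal (lM : (l < M)%N)); rewrite cE /= (negPf (lj : l.+2 != j.+2)).
  by rewrite (bigD1 i) //= iE subrr !mul0r.
(* Exchanging rows 1 and [j.+1] puts the two rows with equal [y] on top. *)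
have det_at (x : nat -> F) (j : 'I_M.+1) :
    \det (interlaced M.+2 (upd (y j.+1)) x) = (-1) ^+ c j *
    ((x j.+1 - x 0%N) * \prod_(i < M) (y (extend_perm (c j) i.+2) - y j.+1) *
     \det (interlaced M (y \o extend_perm (c j) \o S \o S)
             (x \o extend_perm (c j) \o S \o S))).
  have -> : \det (interlaced M.+2 (upd (y j.+1)) x) = (-1) ^+ c j *
      \det (interlaced M.+2 (upd (y j.+1) \o extend_perm (c j)) (x \o extend_perm (c j))).
    by rewrite det_interlaced_perm mulrA -signr_addb addbb mul1r.
  have updE : upd (y j.+1) \o extend_perm (c j) \o S \o S =
      y \o extend_perm (c j) \o S \o S.
    by apply/funext => k /=; rewrite cE /=; case: ifP.
  rewrite det_interlaced_eq01 /= ?c0 ?c1 // updE; congr (_ * (_ * _ * _)).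
  by apply: eq_bigr => i _; move: (congr1 (@^~ (i : nat)) updE) => /= ->.
have [qa sqa qaE] := interlaced_row0_poly M.+1 y a.
have [qb sqb qbE] := interlaced_row0_poly M.+1 y b.
(* As [M] is even, each factor has degree at most [M / 2], so [M.+1] nodes determine the product;
   for odd [M] the bound would be one too large. *)
have spq : (size (qa * qb)%R <= M.+1)%N.
  rewrite (leq_trans (size_polyMleq _ _)) //.
  move: sqa sqb; rewrite -uphalfE uphalf_half (negPf oddM) add0n => sqa sqb.
  by rewrite -[M in (_ <= M.+1)%N]odd_double_half (negPf oddM) -addnn; lia.
have y_inj : injective (fun j : 'I_M.+1 => y j.+1).
  by move=> j l e; apply/val_inj/succn_inj/yI; [exact: (ltn_ord j)|exact: (ltn_ord l)|exact: e].
have upd0 : upd (y 0%N) = y by apply/funext => -[].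
have := congr1 (horner^~ (y 0%N)) (lagrange_interpolation y_inj spq sL Lz).
rewrite hornerM qaE qbE -/(upd _) upd0 horner_sum /cauchy_pfaffian => ->.
rewrite mulr_suml; apply: eq_bigr => j _; rewrite -/(c j) /=.
rewrite hornerZ hornerM qaE qbE -/(upd _) !det_at LE prodf_div.
have -> : vdm M.+2 y = (-1) ^+ c j * ((y j.+1 - y 0%N) *
    \prod_(i < M) (y (extend_perm (c j) i.+2) - y 0%N) *
    (\prod_(i < M) (y (extend_perm (c j) i.+2) - y j.+1) *
     vdm M (y \o extend_perm (c j) \o S \o S))).
  by rewrite -[LHS](signrMK (c j)) -vdm_perm !vdm_recl big_ord_recl /= c0 c1.
rewrite /cauchy_kernel c1.
set P0 := \prod_(i < M) (_ - y 0%N).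
set P1 := \prod_(i < M) (_ - y j.+1).
have P0_neq0 : P0 != 0 by apply/prodf_neq0 => i _; apply: yN0.
have P1_neq0 : P1 != 0 by apply/prodf_neq0 => i _; apply: yN1.
have V_neq0 : vdm M (y \o extend_perm (c j) \o S \o S) != 0.
  apply: vdm_neq0 => k l kM lM /= e; apply/eqP; apply: contraTT isT => kl.
  by have := @yN j k.+2 l.+2 kM lM kl; rewrite e subrr eqxx.
have [->|->] : (-1) ^+ c j = 1 :> F \/ (-1) ^+ c j = -1 :> F by case: (odd_perm _); [right|left].
  by field; rewrite ?yN01 ?P0_neq0 ?P1_neq0 ?V_neq0 ?oppr_eq0 ?oner_eq0.
by field; rewrite ?yN01 ?P0_neq0 ?P1_neq0 ?V_neq0 ?oppr_eq0 ?oner_eq0.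
Qed.

(** Induction on [n]. Antisymmetrizing the last [N] positions first lets the induction hypothesis
    turn all kernels but one into the closed form of size [N]; antisymmetrizing the first-row
    expansion then gives the closed form of size [N.+2]. Characteristic 0 allows the factorials to
    be cancelled. *)
Lemma alternate_cauchy_kernel (F : fieldType) (y a b : nat -> F) (n : nat)
    (r : nat -> nat) :
  [pchar F] =i pred0 -> {in gtn n.*2 &, injective (y \o r)} ->
  alternate n.*2
    (fun r => \prod_(i < n) cauchy_kernel y a b (r i.*2) (r i.*2.+1)) r =
  (2 ^ n * n`!)%:R * cauchy_pfaffian n.*2 (y \o r) (a \o r) (b \o r).
Proof.
move=> F0; elim: n r => [|n IHn] r yI.
  rewrite alternate_alternating => [|s]; last first.
    by rewrite (_ : s = 1%g) ?odd_perm1 ?mul1r ?big_ord0 //; apply/permP => -[].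
  by rewrite /cauchy_pfaffian !det_mx00 /vdm !big_ord0 invr1 !mulr1.
rewrite doubleS in yI *; set N := n.*2 in yI IHn *.
pose K := cauchy_kernel y a b.
pose f M r := cauchy_pfaffian M (y \o r) (a \o r) (b \o r).
pose Phi m r := \prod_(i < m) K (r i.*2) (r i.*2.+1).
pose g r := K (r 0%N) (r 1%N) * f N (r \o S \o S).
rewrite -[LHS]/(alternate N.+2 (Phi n.+1) r) -/(f N.+2 r).
have rI (s : 'S_N.+2) : {in gtn N.+2 &, injective (y \o (r \o extend_perm s))}.
  move=> i j iN jN /= /yI e; apply: (@extend_perm_inj _ s) => //.
  by apply: e; apply: extend_perm_lt.
have step : N`!%:R * alternate N.+2 (Phi n.+1) r =
    (2 ^ n * n`!)%:R * alternate N.+2 g r.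
  have -> : Phi n.+1 = fun r => K (r 0%N) (r 1%N) * Phi n (r \o S \o S).
    by apply/funext => r'; rewrite /Phi big_ord_recl.
  rewrite -(@alternate_tail _ N K) /alternate [RHS]mulr_sumr.
  apply: eq_bigr => s _; rewrite -/(alternate _ _ _) IHn => [|i j iN jN e].
    by rewrite (mulrCA (K _ _)) (mulrCA ((-1) ^+ s)).
  by have [] := rI s i.+2 j.+2 iN jN e.
have expand : (N.+1)%:R * alternate N.+2 g r = (N.+2)`!%:R * f N.+2 r.
  rewrite -(@alternate_alternating _ _ (f N.+2)) => [|s]; last first.
    exact: (@cauchy_pfaffian_perm F N.+2 s (y \o r) (a \o r) (b \o r)).
  pose c (j : 'I_N.+1) : 'S_N.+2 := tperm (lift ord0 ord0) (lift ord0 j).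
  (* The [N.+1] terms of the expansion contribute equally: relabelling by [c j] produces exactly the
     sign that precedes the term. *)
  transitivity (\sum_(j < N.+1) (-1) ^+ c j *
      alternate N.+2 (fun r' => g (r' \o extend_perm (c j))) r).
    rewrite (eq_bigr (fun=> alternate N.+2 g r)) => [|j _].
      by rewrite sumr_const card_ord mulr_natl.
    by rewrite alternate_comp mulrA -signr_addb addbb mul1r.
  rewrite /alternate (eq_bigr _ (fun j _ => mulr_sumr _ _ _ _)) exchange_big /=.
  apply: eq_bigr => s _.
  rewrite [f _ _]cauchy_pfaffian_expand ?odd_double // mulr_sumr.
  apply: eq_bigr => j _; rewrite mulrCA -/(c j); congr (_ * (_ * _)).
  rewrite /g /=; congr (K (r _) _ * _).
  by rewrite [in LHS]extend_perm_tperm.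
have nat0 (m : nat) : (0 < m)%N -> m%:R != 0 :> F.
  by move=> m0; rewrite (pcharf0P F).1 // -lt0n.
apply: (mulfI (nat0 _ (fact_gt0 N.+1))).
rewrite factS natrM -mulrA step mulrCA expand mulrCA.
move: (f N.+2 r) => x; rewrite !mulrA; congr (_ * _).
rewrite -!natrM; congr (_ *+ _).
rewrite [(N.+2)`!]factS [(N.+1)`!]factS expnS [(n.+1)`!]factS.
(* Up to common factors the remaining identity is [N.+2 = 2 * n.+1]. *)
have -> : N = (n * 2)%N by rewrite muln2.
ring.
Qed.

(** * Scaling and evaluation of Pfaffians *)

Lemma prod_pf_pairs (R : comNzRingType) (n : nat) (f : 'I_(2 * n) -> R) :
  \prod_i f i = \prod_(i < n) (f (pf_even i) * f (pf_odd i)).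
Proof.
pose h k := if insub k is Some i then f i else 1.
have hE i : f i = h i by rewrite /h valK.
under eq_bigr do rewrite hE; under [RHS]eq_bigr do rewrite !hE /=.
rewrite -(big_mkord xpredT h) -(big_mkord xpredT (fun i => h (2 * i)%N * h (2 * i).+1)).
elim: n {f hE} h => [|n IHn] h; first by rewrite muln0 !big_nil.
by rewrite [RHS]big_nat_recr //= -IHn mulnS !big_nat_recr //= mulrA.
Qed.

(** In every term of the Pfaffian each index occurs exactly once, whereas [e] occurs once for each
    of the [n] pairs. *)
Lemma Pf_scale (F : fieldType) (n : nat) (e : F) (r : 'I_(2 * n) -> F)
    (A B : 'M[F]_(2 * n)) :
  (forall i j, A i j = e * (r i * r j) * B i j) ->
  Pf A = e ^+ n * (\prod_i r i) * Pf B.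
Proof.
move=> AE; rewrite /Pf mulrCA; congr (_ * _); rewrite mulr_sumr.
apply: eq_bigr => s _; rewrite mulrCA; congr (_ * _).
rewrite (eq_bigr _ (fun i _ => AE _ _)) big_split /=; congr (_ * _).
rewrite big_split /= prodr_const card_ord; congr (_ * _).
rewrite [RHS](reindex_inj (@perm_inj _ s)).
by rewrite prod_pf_pairs.
Qed.

Lemma Pf_cauchy_kernel (F : fieldType) (n : nat) (y a b : nat -> F) :
  [pchar F] =i pred0 -> {in gtn (2 * n) &, injective y} ->
  Pf (\matrix_(i < 2 * n, j < 2 * n) cauchy_kernel y a b i j) =
  cauchy_pfaffian (2 * n) y a b.
Proof.
move=> F0 yI.
transitivity (((2 ^ n * n`!)%N%:R)^-1 * alternate (2 * n)
    (fun r => \prod_(i < n) cauchy_kernel y a b (r i.*2) (r i.*2.+1)) id).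
  congr (_ * _); apply: eq_bigr => s _; congr (_ * _); apply: eq_bigr => i _.
  rewrite mxE /= -!extend_permE /= -mul2n.
  by [].
have {}yI : {in gtn n.*2 &, injective (y \o id)} by rewrite -mul2n.
rewrite mul2n alternate_cauchy_kernel //.
rewrite mulrA mulVf ?mul1r //.
by rewrite ((pcharf0P F).1 F0) muln_eq0 expn_eq0 -lt0n fact_gt0.
Qed.

(** * Chebyshev polynomials and their alternants *)

(** The second kind with halved argument, [U_k(t / 2)]: monic with integer coefficients, and at
    [t = z + z^-1] the quotient of [z ^+ k.+1 - z ^- k.+1] by [z - z^-1]. *)
Fixpoint chebyshev (R : nzRingType) (t : R) (k : nat) : R :=
  if k is k'.+1 then
    if k' is k''.+1 then t * chebyshev t k' - chebyshev t k'' else t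
  else 1.

Lemma chebyshevSS (R : nzRingType) (t : R) (k : nat) :
  chebyshev t k.+2 = t * chebyshev t k.+1 - chebyshev t k.
Proof. by []. Qed.

Lemma rmorph_chebyshev (R S : nzRingType) (f : {rmorphism R -> S}) (t : R) (k : nat) :
  f (chebyshev t k) = chebyshev (f t) k.
Proof.
suff: f (chebyshev t k) = chebyshev (f t) k /\
    f (chebyshev t k.+1) = chebyshev (f t) k.+1 by case.
elim: k => [|k [IH0 IH1]]; first by rewrite rmorph1.
by split; rewrite // !chebyshevSS rmorphB rmorphM IH0 IH1.
Qed.

Lemma chebyshev_laurent (F : fieldType) (z : F) (k : nat) :
  z != 0 ->
  z ^+ k.+1 - z ^- k.+1 = (z - z^-1) * chebyshev (z + z^-1) k.
Proof.
move=> z0; suff: z ^+ k.+1 - z ^- k.+1 = (z - z^-1) * chebyshev (z + z^-1) k /\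
    z ^+ k.+2 - z ^- k.+2 = (z - z^-1) * chebyshev (z + z^-1) k.+1 by case.
elim: k => [|k [IH0 IH1]]; first by split; rewrite /=; field.
split=> //; rewrite chebyshevSS mulrBr mulrCA -IH1 -IH0 !exprS.
by field; rewrite expf_neq0.
Qed.

Lemma chebyshevX_monic (R : nzRingType) (k : nat) :
  chebyshev ('X : {poly R}) k \is monic /\ size (chebyshev ('X : {poly R}) k) = k.+1.
Proof.
pose u k : {poly R} := chebyshev 'X k.
suff: (u k \is monic /\ size (u k) = k.+1) /\
    (u k.+1 \is monic /\ size (u k.+1) = k.+2) by case.
elim: k => [|k [IH0 [IHm IHs]]].
  by rewrite /u /= monic1 monicX size_poly1 size_polyX.
split=> //; have uE : u k.+2 = 'X * u k.+1 - u k by [].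
have s2 : size ('X * u k.+1) = k.+3.
  by rewrite -commr_polyX size_mulX ?IHs // monic_neq0.
have lt : (size (- u k) < size ('X * u k.+1)%R)%N by rewrite size_polyN s2 IH0.2.
rewrite uE size_polyDl // s2; split=> //.
by rewrite monicE lead_coefDl // lead_coef_monicM ?monicX // (monicP IHm).
Qed.

Lemma det_monic_horner (R : comNzRingType) (N : nat) (P : nat -> {poly R})
    (z : nat -> R) :
  (forall k, P k \is monic /\ size (P k) = k.+1) ->
  \det (\matrix_(i < N, j < N) (P j).[z i]) = vdm N z.
Proof.
move=> Pm; rewrite vdmE.
rewrite (@det_unitriangular _ _ (fun j i => (P j).[z i]) (fun j i => z i ^+ j)) //.
move=> j _; exists (fun l => (P j)`_l) => i; have [/monicP lc sz] := Pm j.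
rewrite horner_coef sz big_ord_recr /= addrC; congr (_ + _).
by rewrite lead_coefE sz in lc; rewrite lc mul1r.
Qed.

(** Newton's form needs no division, hence works over polynomial rings with integer coefficients:
    each new coefficient is the value of the previous remainder at the next node, split off by the
    factor theorem. *)
Lemma newton_interpolation (R : comNzRingType) (N : nat) (z : nat -> R) (P : {poly R}) :
  exists c : nat -> R, forall i, (i < N)%N ->
    P.[z i] = \sum_(k < N) \prod_(l < k) (z i - z l) * c k.
Proof.
suff [c [Q PE]] : exists c : nat -> R, exists Q : {poly R},
    P = \sum_(k < N) (\prod_(l < k) ('X - (z l)%:P)) * (c k)%:P +
        (\prod_(l < N) ('X - (z l)%:P)) * Q.
  exists c => i iN; rewrite PE hornerD hornerM horner_prod.
  rewrite [X in _ + X * _](bigD1 (Ordinal iN)) //= hornerXsubC subrr !mul0r addr0.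
  rewrite horner_sum.
  apply: eq_bigr => k _; rewrite hornerM hornerC horner_prod; congr (_ * _).
  by apply: eq_bigr => l _; rewrite hornerXsubC.
elim: N => [|N [c [Q ->]]].
  by exists (fun=> 0), P; rewrite !big_ord0 mul1r add0r.
have /factor_theorem[Q' QE] : root (Q - (Q.[z N])%:P) (z N).
  by rewrite rootE hornerD hornerN hornerC subrr.
exists (fun k => if (k < N)%N then c k else Q.[z N]), Q'.
rewrite !big_ord_recr /= ltnn -addrA; congr (_ + _).
  by apply: eq_bigr => k _; rewrite ltn_ord.
rewrite -mulrA -mulrDr; congr (_ * _).
by rewrite (mulrC _ Q') -QE addrC subrK.
Qed.

(** Newton's form factors the matrix into a lower triangular one, whose diagonal product is the
    Vandermonde product, and the matrix of coefficients. *)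
Lemma det_horner_vdm (R : comNzRingType) (N : nat) (P : 'I_N -> {poly R})
    (z : nat -> R) :
  exists c, \det (\matrix_(i < N, j < N) (P j).[z i]) = c * vdm N z.
Proof.
have [c cE] := boolp.choice (fun j => newton_interpolation N z (P j)).
pose L : 'M[R]_N := \matrix_(i, k) \prod_(l < k) (z i - z l).
exists (\det (\matrix_(k < N, j < N) c j k)).
have -> : \matrix_(i < N, j < N) (P j).[z i] = L *m \matrix_(k, j) c j k.
  apply/matrixP => i j; rewrite !mxE cE //.
  by apply: eq_bigr => k _; rewrite !mxE.
rewrite det_mulmx mulrC; congr (_ * _); rewrite det_trig.
  rewrite /vdm (exchange_big_dep xpredT) //=; apply: eq_bigr => i _; rewrite mxE.
  by rewrite (big_ord_widen N (fun l => z i - z l)) // ltnW.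
apply/is_trig_mxP => i k ik; rewrite mxE.
by rewrite (bigD1 (Ordinal ik)) //= subrr mul0r.
Qed.

(** The corrections to column [j] that [det_unitriangular] permits. *)
Definition lower_span (T : Type) (R : nzRingType) (u : nat -> T -> R) (j : nat)
    (f : T -> R) : Prop :=
  exists c : nat -> R, forall t, f t = \sum_(l < j) c l * u l t.

Lemma lower_spanD (T : Type) (R : nzRingType) (u : nat -> T -> R) (j : nat)
    (f g : T -> R) :
  lower_span u j f -> lower_span u j g -> lower_span u j (fun t => f t + g t).
Proof.
move=> [c cE] [d dE]; exists (fun l => c l + d l) => t.
by rewrite cE dE -big_split; apply: eq_bigr => l _; rewrite mulrDl.
Qed.

Lemma lower_spanZ (T : Type) (R : nzRingType) (u : nat -> T -> R) (j : nat)
    (e : R) (f : T -> R) :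
  lower_span u j f -> lower_span u j (fun t => e * f t).
Proof.
move=> [c cE]; exists (fun l => e * c l) => t.
by rewrite cE mulr_sumr; apply: eq_bigr => l _; rewrite mulrA.
Qed.

Lemma lower_span_sum (T : Type) (R : nzRingType) (u : nat -> T -> R) (j m : nat)
    (f : nat -> T -> R) :
  (forall l, (l < m)%N -> lower_span u j (f l)) ->
  lower_span u j (fun t => \sum_(l < m) f l t).
Proof.
elim: m => [|m IHm] fS.
  by exists (fun=> 0) => t; rewrite big_ord0 big1 // => l _; rewrite mul0r.
have [c cE] := lower_spanD (IHm (fun l lm => fS l (ltnW lm))) (fS m (ltnSn m)).
by exists c => t; rewrite big_ord_recr -cE.
Qed.

Lemma lower_span_mem (T : Type) (R : nzRingType) (u : nat -> T -> R) (j l : nat) :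
  (l < j)%N -> lower_span u j (u l).
Proof.
move=> lj; exists (fun l' => (l' == l)%:R) => t.
rewrite (bigD1 (Ordinal lj)) //= eqxx mul1r big1 ?addr0 // => l'.
by rewrite -val_eqE /= => /negPf ->; rewrite mul0r.
Qed.

(** At [t = w + w^-1] the cubic [t ^+ 3 - 3 * t] is [w ^+ 3 + w ^- 3], so multiplying by it sends
    [U_k] to [U_(k+3) + U_(k-3)]. The degrees [j + j./2] grow by 3 when [j] grows by 2; hence the
    interlaced columns [w j] are the Chebyshev columns [u j] plus combinations of earlier ones. *)
Lemma det_chebyshev_half (R : comNzRingType) (N : nat) (z : nat -> R) :
  \det (\matrix_(i < N, j < N) chebyshev (z i) (j + j./2)) =
  \det (interlaced N (fun i => z i ^+ 3 - 3%:R * z i) z).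
Proof.
pose u j t : R := chebyshev t (j + j./2).
pose w j t : R := (t ^+ 3 - 3%:R * t) ^+ j./2 * t ^+ odd j.
have uS j t : u j.+2 t = chebyshev t (j + j./2).+3 by rewrite /u addnS.
(* For [j] equal to 0 and 1 the index [k - 3] is negative, and [U_(-3) = - U_1], [U_(-2) = - U_0]
   give the witnesses. *)
have yu j : exists2 s, lower_span u j.+2 s &
    forall t, (t ^+ 3 - 3%:R * t) * u j t = u j.+2 t + s t.
  case: j => [|[|j]].
  - exists (fun t => -1 * u 1%N t); first exact/lower_spanZ/lower_span_mem.
    by move=> t; rewrite /u /=; ring.
  - exists (fun t => -1 * u 0%N t); first exact/lower_spanZ/lower_span_mem.
    by move=> t; rewrite /u /=; ring.
  exists (u j); first by apply: lower_span_mem; rewrite ltnW // ltnS ltnW.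
  have jE : (j.+2 + j.+2./2 = (j + j./2).+3)%N by rewrite /= addnS.
  move=> t; rewrite !uS jE /u.
  by move: (j + _)%N => k; rewrite !chebyshevSS; ring.
have [s sS wE] : exists2 s : nat -> R -> R, forall j, lower_span u j (s j) &
    forall j t, w j t = u j t + s j t.
  suff wS j : exists2 s, lower_span u j s & forall t, w j t = u j t + s t.
    have [s sE] := boolp.choice (fun j => let: ex_intro2 s sS sE := wS j in
      ex_intro (fun s => lower_span u j s /\ forall t, w j t = u j t + s t)
        s (conj sS sE)).
    by exists s => j; case: (sE j).
  elim/ltn_ind: j => -[|[|j]] IH.
  - exists (fun=> 0); last by move=> t; rewrite /w /u /= mulr1 addr0.
    by exists (fun=> 0) => t; rewrite big_ord0.
  - exists (fun=> 0); last by move=> t; rewrite /w /u /= mul1r addr0.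
    by exists (fun=> 0) => t; rewrite big1 // => l _; rewrite mul0r.
  have [s [c cE] wE] := IH j (leqnSn _).
  have [s' s'S yE] := yu j.
  exists (fun t => s' t + \sum_(l < j) c l * ((t ^+ 3 - 3%:R * t) * u l t)).
    apply: lower_spanD => //; apply: (@lower_span_sum _ _ u j.+2 j
      (fun l t => c l * ((t ^+ 3 - 3%:R * t) * u l t))) => l lj.
    apply: lower_spanZ; have [r [d dE] rE] := yu l.
    have [e eE] : lower_span u j.+2 (fun t => u l.+2 t + r t).
      apply: lower_spanD; first exact: lower_span_mem.
      exists (fun k => if (k < l.+2)%N then d k else 0) => t; rewrite dE.
      rewrite (big_ord_widen j.+2 (fun k => d k * u k t)) ?ltnS 1?ltnW // big_mkcond.
      by apply: eq_bigr => k _; case: ifP; rewrite ?mul0r.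
    by exists e => t; rewrite rE eE.
  move=> t; rewrite /w /= negbK exprS -mulrA -/(w j t) wE mulrDr yE -addrA cE.
  by rewrite mulr_sumr; do 2!congr (_ + _); apply: eq_bigr => l _; rewrite mulrCA.
symmetry; apply: (@det_unitriangular _ _ (fun j i => w j (z i)) (fun j i => u j (z i))).
move=> j _; have [c cE] := sS j; exists c => i.
by rewrite wE cE.
Qed.

(** * Evaluation of Laurent polynomials *)

Lemma tofrac_meval_neq0 (R : idomainType) (N : nat) (v : 'I_N -> R) (p : {mpoly R[N]}) :
  p.@[v] != 0 -> tofrac p != 0.
Proof.
by apply: contraNneq => /eqP; rewrite tofrac_eq0 => /eqP->; rewrite meval0.
Qed.

(** The relational form of [laurent_eval]: any representation may be used, so values can be built up
    through sums and products. *)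
Definition laurent_value (N : nat) (F : fieldType) (v : 'I_N -> F)
    (f : {fraction {mpoly int[N]}}) (e : F) : Prop :=
  exists p k, f = tofrac p / tofrac (\prod_(i < N) 'X_i) ^+ k /\
    e = mmap (intmul 1) v p / (\prod_(i < N) v i) ^+ k.

Lemma tofrac_X_neq0 (R : idomainType) (N : nat) (i : 'I_N) :
  tofrac ('X_i : {mpoly R[N]}) != 0.
Proof.
by apply: (@tofrac_meval_neq0 _ _ (fun=> 1)); rewrite mevalXU oner_neq0.
Qed.

Lemma tofrac_prodX_neq0 (R : idomainType) (N : nat) :
  tofrac (\prod_(i < N) 'X_i : {mpoly R[N]}) != 0.
Proof.
apply: (@tofrac_meval_neq0 _ _ (fun=> 1)).
by rewrite rmorph_prod big1 ?oner_neq0 // => i _; rewrite /= mevalXU.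
Qed.

(** Two representations of [f] agree in the polynomial ring after cross-multiplication; evaluating
    that identity and dividing by the nonzero product of the [v i] shows that the chosen
    representation gives the same value. *)
Lemma laurent_eval_value (N : nat) (F : fieldType) (v : 'I_N -> F)
    (f : {fraction {mpoly int[N]}}) (e : F) :
  (forall i, v i != 0) -> laurent_value v f e -> laurent_eval f v = e.
Proof.
move=> v0 [p [k [fE ->]]]; rewrite /laurent_eval.
have : f = tofrac (laurent_rep f).1 / tofrac (\prod_(i < N) 'X_i) ^+ (laurent_rep f).2.
  apply: (@xgetPex _ (0, 0%N)
    [set pk | f = tofrac pk.1 / tofrac (\prod_(i < N) 'X_i) ^+ pk.2]%classic).
  by exists (p, k).
case: (laurent_rep f) => q m /=; rewrite fE => /eqP.
have X0 := tofrac_prodX_neq0 int N; set X := \prod_(i < N) 'X_i in X0 *.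
rewrite eqr_div ?expf_neq0 // -!tofracXn -!tofracM tofrac_eq => /eqP e'.
have pv0 : \prod_(i < N) v i != 0 by apply/prodf_neq0.
have Xv : mmap (intmul 1) v X = \prod_(i < N) v i.
  by rewrite rmorph_prod; apply: eq_bigr => i _; rewrite /= mmapX mmap1U.
have := congr1 (mmap (intmul 1) v) e'; rewrite !rmorphM !rmorphXn /= Xv => e2.
by apply/esym/eqP; rewrite eqr_div ?expf_neq0 //; apply/eqP.
Qed.

Lemma laurent_valueD (N : nat) (F : fieldType) (v : 'I_N -> F)
    (f g : {fraction {mpoly int[N]}}) (d e : F) :
  (forall i, v i != 0) -> laurent_value v f d -> laurent_value v g e ->
  laurent_value v (f + g) (d + e).
Proof.
move=> v0 [p [k [-> ->]]] [q [m [-> ->]]].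
have X0 := tofrac_prodX_neq0 int N; set X := \prod_(i < N) 'X_i in X0 *.
have pv0 : \prod_(i < N) v i != 0 by apply/prodf_neq0.
have Xv : mmap (intmul 1) v X = \prod_(i < N) v i.
  by rewrite rmorph_prod; apply: eq_bigr => i _; rewrite /= mmapX mmap1U.
exists (p * X ^+ m + q * X ^+ k), (k + m)%N; split.
  by rewrite tofracD !tofracM !tofracXn addf_div ?expf_neq0 // exprD.
by rewrite rmorphD !rmorphM !rmorphXn /= Xv addf_div ?expf_neq0 // exprD.
Qed.

Lemma laurent_valueM (N : nat) (F : fieldType) (v : 'I_N -> F)
    (f g : {fraction {mpoly int[N]}}) (d e : F) :
  laurent_value v f d -> laurent_value v g e -> laurent_value v (f * g) (d * e).
Proof.
move=> [p [k [-> ->]]] [q [m [-> ->]]]; exists (p * q), (k + m)%N.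
by split; rewrite ?tofracM ?rmorphM /= mulf_div exprD.
Qed.

Lemma laurent_value_int (N : nat) (F : fieldType) (v : 'I_N -> F) (c : int) :
  laurent_value v c%:~R c%:~R.
Proof.
exists c%:~R, 0%N; rewrite !divr1; split; first by rewrite rmorph_int.
by rewrite (rmorph_int (mmap (intmul 1) v)).
Qed.

Lemma add_inv_inj (F : fieldType) (x y : F) :
  x != 0 -> y != 0 -> x * y - 1 != 0 -> x + x^-1 = y + y^-1 -> x = y.
Proof.
move=> x0 y0 xy1 e; apply/subr0_eq/(mulIf xy1); rewrite mul0r.
have -> : (x - y) * (x * y - 1) = x * y * ((x + x^-1) - (y + y^-1)).
  by field; rewrite x0 y0.
by rewrite e subrr mulr0.
Qed.

Lemma laurent_value_var (N : nat) (F : fieldType) (v : 'I_N -> F) (i : 'I_N) :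
  (forall i, v i != 0) ->
  laurent_value v (tofrac 'X_i + (tofrac 'X_i)^-1) (v i + (v i)^-1).
Proof.
move=> v0; apply: laurent_valueD => //.
  by exists 'X_i, 0%N; rewrite !divr1 mmapX mmap1U.
(* The inverse of a variable is the product of the other variables over the product of all. *)
exists (\prod_(j < N | j != i) 'X_j), 1%N; rewrite !expr1; split.
  have := tofrac_prodX_neq0 int N.
  rewrite (bigD1 i) //= tofracM mulf_eq0 negb_or => /andP[x0 y0].
  by rewrite invfM mulrCA divff ?mulr1.
have : \prod_(j < N | j != i) v j != 0 by apply/prodf_neq0.
rewrite rmorph_prod /= [X in _ / X](bigD1 i) //= => y0.
rewrite (eq_bigr (fun j => v j)) => [|j _]; last by rewrite mmapX mmap1U.
by rewrite invfM mulrCA divff ?mulr1.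
Qed.

Lemma laurent_value_mmap (N M : nat) (F : fieldType) (v : 'I_N -> F)
    (h : 'I_M -> {fraction {mpoly int[N]}}) (e : 'I_M -> F) (p : {mpoly int[M]}) :
  (forall i, v i != 0) -> (forall i, laurent_value v (h i) (e i)) ->
  laurent_value v (mmap (intmul 1) h p) (mmap (intmul 1) e p).
Proof.
move=> v0 he; have L1 : laurent_value v 1 1 by apply: (laurent_value_int v 1).
elim/mpolyind: p => [|c m p _ _ IHp].
  by rewrite !rmorph0; apply: (laurent_value_int v 0).
rewrite !rmorphD /= !mmapZ !mmapX; apply: laurent_valueD => //.
apply: laurent_valueM; first exact: laurent_value_int.
rewrite /mmap1; apply: (@big_ind2 _ _ (laurent_value v)) => // [*|i _].
  exact: laurent_valueM.
by elim: (m i) => // k IHk; rewrite !exprS; apply: laurent_valueM.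
Qed.

(** * Symplectic characters through Chebyshev determinants *)

Definition ext0 (R : nmodType) (N : nat) (z : 'I_N -> R) (k : nat) : R :=
  if insub k is Some i then z i else 0.

Lemma ext0E (R : nmodType) (N : nat) (z : 'I_N -> R) (i : 'I_N) : ext0 z i = z i.
Proof. by rewrite /ext0 valK. Qed.

Lemma ext0_inj (R : nmodType) (N : nat) (z : 'I_N -> R) :
  injective z -> {in gtn N &, injective (ext0 z)}.
Proof.
move=> zI i j iN jN.
by rewrite (ext0E z (Ordinal iN)) (ext0E z (Ordinal jN)) => /zI[].
Qed.

Lemma det_rev_col (R : comNzRingType) (N : nat) (A : 'M[R]_N) :
  \det (\matrix_(i, j) A i (rev_ord j)) = (-1) ^+ perm (@rev_ord_inj N) * \det A.
Proof.
rewrite -det_perm mulrC -[X in _ * X]det_tr tr_perm_mx -det_mulmx.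
by rewrite -col_permE; congr (\det _); apply/matrixP => i j; rewrite !mxE permE.
Qed.

Lemma rmorph_vdm (R S : comNzRingType) (f : {rmorphism R -> S}) (N : nat)
    (z : 'I_N -> R) :
  f (vdm N (ext0 z)) = vdm N (ext0 (fun i => f (z i))).
Proof.
rewrite rmorph_prod; apply: eq_bigr => i _; rewrite rmorph_prod.
by apply: eq_bigr => j _; rewrite rmorphB !ext0E.
Qed.

Lemma horner_chebyshev (R : comNzRingType) (t : R) (k : nat) :
  (chebyshev 'X k).[t] = chebyshev t k.
Proof. by rewrite -[LHS]/(horner_eval t _) rmorph_chebyshev /= /horner_eval hornerX. Qed.

Lemma det_chebyshev_id (R : comNzRingType) (N : nat) (z : 'I_N -> R) :
  \det (\matrix_(i < N, j < N) chebyshev (z i) j) = vdm N (ext0 z).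
Proof.
rewrite -(det_monic_horner N (ext0 z) (@chebyshevX_monic R)).
by congr (\det _); apply/matrixP => i j; rewrite !mxE horner_chebyshev ext0E.
Qed.

Lemma tofrac_exp_neq1 (R : idomainType) (N m : nat) (i : 'I_N) :
  (0 < m)%N -> (tofrac ('X_i : {mpoly R[N]})) ^+ m != 1.
Proof.
move=> m0; rewrite -subr_eq0 -tofracXn -tofrac1 -tofracB.
apply: (@tofrac_meval_neq0 _ _ (fun=> 0)).
rewrite rmorphB rmorphXn rmorph1 /= mevalXU expr0n.
by rewrite gtn_eqF // sub0r oppr_eq0 oner_eq0.
Qed.

Lemma sigma_neq0 (F : fieldType) (t : F) : t != 0 -> t ^+ 2 != 1 -> sigma t != 0.
Proof.
move=> t0; apply: contra_neq => /subr0_eq e.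
by rewrite expr2 {2}e divff.
Qed.

(** By [add_inv_inj] two polynomials must not vanish: the origin shows that the product of two
    powers differs from 1, and the indicator of [i] separates the two variables. *)
Lemma tofrac_add_inv_inj (R : idomainType) (N m : nat) :
  (0 < m)%N ->
  injective (fun i : 'I_N => (tofrac ('X_i : {mpoly R[N]})) ^+ m +
                             ((tofrac ('X_i : {mpoly R[N]})) ^+ m)^-1).
Proof.
move=> m0 i j.
have x0 k : (tofrac ('X_k : {mpoly R[N]})) ^+ m != 0.
  by rewrite expf_neq0 // tofrac_X_neq0.
have xx1 : (tofrac ('X_i : {mpoly R[N]})) ^+ m * (tofrac ('X_j : {mpoly R[N]})) ^+ m - 1 != 0.
  rewrite -!tofracXn -tofracM -tofrac1 -tofracB.
  apply: (@tofrac_meval_neq0 _ _ (fun=> 0)).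
  rewrite rmorphB rmorphM !rmorphXn rmorph1 /= !mevalXU expr0n.
  by rewrite gtn_eqF // mulr0 sub0r oppr_eq0 oner_eq0.
move/(add_inv_inj (x0 i) (x0 j) xx1) => e; apply/eqP.
apply: contra_eqT e => ij; rewrite -subr_eq0 -!tofracXn -tofracB.
apply: (@tofrac_meval_neq0 _ _ (fun k => (k == i)%:R)).
rewrite rmorphB !rmorphXn /= !mevalXU eqxx (eq_sym j) (negPf ij).
by rewrite expr1n expr0n gtn_eqF // subr0 oner_neq0.
Qed.

(* The universal quotient of alternants in the variables [z + z^-1]; evaluating
   it needs no division, so points with [z = 1] are not special. *)
Lemma det_chebyshev_dvd (N : nat) (e : nat -> nat) :
  exists c : {mpoly int[N]}, forall (R : comNzRingType) (z : 'I_N -> R),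
    \det (\matrix_(i < N, j < N) chebyshev (z i) (e j)) =
    mmap (intmul 1) z c * vdm N (ext0 z).
Proof.
have [c cE] := det_horner_vdm (fun j : 'I_N => chebyshev 'X (e j))
  (ext0 (fun i => 'X_i : {mpoly int[N]})).
exists c => R z; have := congr1 (mmap (intmul 1) z) cE.
rewrite rmorphM /= rmorph_vdm /=.
have -> : (fun i => mmap (intmul 1) z 'X_i) = z.
  by apply/funext => i; rewrite mmapX mmap1U.
move=> <-; rewrite -det_map_mx; congr (\det _); apply/matrixP => i j.
by rewrite !mxE horner_chebyshev ext0E rmorph_chebyshev /= mmapX mmap1U.
Qed.

(** The columns are reversed to make the index of the Chebyshev polynomials increase with [j]. The
    sign of the reversal stays unevaluated, since it cancels in the quotient of alternants. *)
Lemma sp_alternant_chebyshev (N : nat) (lam : seq nat) :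
  let z (i : 'I_N) : {fraction {mpoly int[N]}} := tofrac 'X_i in
  sp_alternant N lam = (-1) ^+ perm (@rev_ord_inj N) * ((\prod_i (z i - (z i)^-1)) *
    \det (\matrix_(i, j) chebyshev (z i + (z i)^-1) (nth 0%N lam (N - j.+1) + j))).
Proof.
move=> z; rewrite -det_scale_rows -[LHS](signrMK (perm (@rev_ord_inj N))).
rewrite -det_rev_col; congr (_ * \det _); apply/matrixP => i j; rewrite !mxE /=.
have z0 : z i != 0 by apply: tofrac_X_neq0.
by rewrite -chebyshev_laurent // subKn ?addnS.
Qed.

(** For generic variables the common factors and the Vandermonde product are nonzero and cancel,
    leaving the integral polynomial [c] in the [z + z^-1], which is then evaluated at [v]. The form
    without division remains valid where the Vandermonde product at [v] vanishes. *)
Lemma Sp_vdm (N : nat) (F : fieldType) (lam : seq nat) (v : 'I_N -> F) :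
  (forall i, v i != 0) ->
  Sp N lam v * vdm N (ext0 (fun i => v i + (v i)^-1)) =
  \det (\matrix_(i < N, j < N)
    chebyshev (v i + (v i)^-1) (nth 0%N lam (N - j.+1) + j)).
Proof.
move=> v0; pose z (i : 'I_N) : {fraction {mpoly int[N]}} := tofrac 'X_i.
have z0 i : z i != 0 by apply: tofrac_X_neq0.
have zI : injective (fun i => z i + (z i)^-1) by apply: (@tofrac_add_inv_inj _ _ 1).
have P0 : \prod_i (z i - (z i)^-1) != 0.
  by apply/prodf_neq0 => i _; rewrite sigma_neq0 // tofrac_exp_neq1.
have V0 : vdm N (ext0 (fun i => z i + (z i)^-1)) != 0 by apply/vdm_neq0/ext0_inj.
have [c cE] := det_chebyshev_dvd N (fun j => nth 0%N lam (N - j.+1) + j)%N.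
rewrite cE /Sp; congr (_ * _); apply: laurent_eval_value => //.
rewrite !sp_alternant_chebyshev /= -/z cE.
under [X in _ / (_ * (_ * \det X))]eq_mx do rewrite nth_nil add0n.
rewrite det_chebyshev_id.
rewrite (mulrCA (\prod_i _)) (mulrCA ((-1) ^+ _)) mulfK; last first.
  by apply: mulf_neq0 (mulf_neq0 P0 V0); rewrite signr_eq0.
by apply: laurent_value_mmap => // i; apply: laurent_value_var.
Qed.

(** * The partitions [delta] and the determinant with a last variable equal to 1 *)

Lemma perm_iota_half (N : nat) :
  perm_eq (iota 0 (uphalf N) ++ iota 0 N./2) (mkseq half N).
Proof.
elim: N => // N IHN.
have -> : uphalf N.+1 = (N./2 + 1)%N by rewrite addn1.
rewrite -uphalfE mkseqS iotaD /= add0n -catA perm_sym perm_rcons perm_sym.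
by rewrite perm_catC -catA /= perm_cons.
Qed.

(** Both sides are non-increasing and consist of the first [N] terms of 0, 0, 1, 1, 2, 2, ...; even
    and odd [N] give the two partitions of the theorem. *)
Lemma sort_delta (N : nat) :
  sort geq (rev (iota 0 (uphalf N)) ++ rev (iota 0 N./2)) = rev (mkseq half N).
Proof.
have geqT : transitive geq by move=> i j k /= ji kj; apply: leq_trans kj ji.
apply: (@sorted_eq _ geq) => //.
- by move=> i j /= e; apply/eqP; rewrite eqn_leq andbC.
- by apply: sort_sorted => i j /=; apply: leq_total.
- rewrite rev_sorted; apply: (homo_sorted (e := leq)); last exact: iota_sorted.
  exact: half_leq.
rewrite perm_sort -rev_cat perm_rev perm_catC perm_sym perm_rev perm_sym.
exact: perm_iota_half.
Qed.

Lemma nth_rev_half (N j : nat) :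
  (j < N)%N -> nth 0%N (rev (mkseq half N)) (N - j.+1) = j./2.
Proof.
move=> jN; rewrite nth_rev size_mkseq ?nth_mkseq //; last lia.
  by rewrite -subSn // subSS subKn // ltnW.
all: by lia.
Qed.

Lemma delta2_even (n : nat) :
  delta2 (n.+1%:Z - 1) (n.+1%:Z - 1) = rev (mkseq half (2 * n.+1)).
Proof. by rewrite -addn1 PoszD addrK mul2n addn1 -sort_delta uphalf_double doubleK. Qed.

Lemma delta2_odd (n : nat) :
  delta2 n.+1 (n.+1%:Z - 1) = rev (mkseq half (2 * n.+1).+1).
Proof.
have -> : n.+1%:Z - 1 = n by rewrite -addn1 PoszD addrK.
by rewrite -sort_delta mul2n /= uphalf_double doubleK.
Qed.

Lemma vdm_recr (R : comNzRingType) (N : nat) (y : nat -> R) :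
  vdm N.+1 y = vdm N y * \prod_(i < N) (y N - y i).
Proof.
rewrite /vdm big_ord_recr /= [X in _ * X]big1 ?mulr1 => [|j]; last first.
  by rewrite ltnNge -ltnS ltn_ord.
rewrite -big_split; apply: eq_bigr => i _ /=.
by rewrite big_mkcond big_ord_recr /= ltn_ord -big_mkcond.
Qed.

(** At [z = 2] the cubic [y] is also 2, and in general [y - 2 = (z - 2) * (z + 1) ^+ 2]. Subtracting
    twice the column [y ^+ m] from both [y ^+ m * z] and [y ^+ m.+1] leaves [(1, 0, ..., 0)] as last
    row and a factor [z - 2] in the other entries of the later columns. The cofactor sign is 1
    because [N] is even. *)
Lemma det_interlaced_last2 (R : comNzRingType) (N : nat) (z : nat -> R) :
  ~~ odd N -> z N = 2%:R ->
  \det (interlaced N.+1 (fun i => z i ^+ 3 - 3%:R * z i) z) =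
  \prod_(i < N) (z i - 2%:R) *
  \det (interlaced N (fun i => z i ^+ 3 - 3%:R * z i) (fun i => (z i + 1) ^+ 2)).
Proof.
move=> oddN zN; pose y i := z i ^+ 3 - 3%:R * z i.
pose h (k : nat) (i : 'I_N.+1) := y i ^+ k./2 * z i ^+ odd k.
pose g (k : nat) (i : 'I_N.+1) :=
  if k is k'.+1 then h k i - 2%:R * h k'./2.*2 i else 1.
rewrite -[LHS]/(\det (\matrix_(i, k) h k i)) -(@det_unitriangular _ _ g h).
  have yN : y N = 2%:R by rewrite /y zN; ring.
  rewrite (expand_det_row _ ord_max) big_ord_recl mxE /= mul1r.
  rewrite [X in _ + X]big1 ?addr0 => [|j _]; last first.
    rewrite mxE /g /= /h /= yN zN uphalf_half doubleK odd_double.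
    by case: (odd j) => /=; rewrite ?add1n ?add0n ?exprS ?expr1 ?expr0; ring.
  rewrite /cofactor addn0 -signr_odd (negPf oddN) mul1r.
  rewrite -(det_scale_rows (fun i : 'I_N => z i - 2%:R)); congr (\det _).
  apply/matrixP => i j; rewrite !mxE /g /= /h /= /bump (leqNgt N) ltn_ord /=.
  rewrite uphalf_half doubleK odd_double -/(y i).
  by case: (odd j) => /=; rewrite ?add1n ?add0n ?exprS ?expr1 ?expr0 /y; ring.
move=> [|k] _; first by exists (fun=> 0) => i; rewrite big_ord0 addr0 /g /h mul1r.
exists (fun l => if l == k./2.*2 then - 2%:R else 0) => i.
have kk : (k./2.*2 < k.+1)%N by rewrite ltnS -[X in (_ <= X)%N]odd_double_half leq_addl.
rewrite /g; congr (_ + _); rewrite (bigD1 (Ordinal kk)) //= eqxx mulNr.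
rewrite big1 ?addr0 // => l; rewrite -val_eqE /= => /negPf ->.
by rewrite mul0r.
Qed.

Lemma prod_pairs (R : comNzRingType) (N : nat) (w : 'I_N -> R) :
  \prod_(i < N) \prod_(j < N | (i < j)%N) (w i * w j) = \prod_i w i ^+ N.-1.
Proof.
rewrite (eq_bigr (fun i : 'I_N => (\prod_(j < N | (i < j)%N) w i) *
  \prod_(j < N | (i < j)%N) w j)) => [|i _]; last exact: big_split.
rewrite big_split /=.
rewrite [X in _ * X](exchange_big_dep xpredT) //= -big_split /=.
apply: eq_bigr => i _; rewrite -[X in _ ^+ X.-1]card_ord -(cardC1 i) -prodr_const.
rewrite [RHS](bigID (fun j : 'I_N => (i < j)%N)) /=; congr (_ * _).
  by apply: eq_bigl => j; rewrite !inE -val_eqE /=; case: ltngtP.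
by apply: eq_bigl => j; rewrite !inE -val_eqE /=; case: ltngtP.
Qed.

(** * Reduction to the kernel and the matrix entries at the two roots of unity *)

Lemma sigma_mul_eq (F : fieldType) (x y : F) :
  x != 0 -> y != 0 ->
  sigma (y / x) * sigma (x * y) =
  (y ^+ 2 + (y ^+ 2)^-1) - (x ^+ 2 + (x ^+ 2)^-1).
Proof. by move=> x0 y0; rewrite /sigma; field; rewrite x0 y0. Qed.

(** The factors [sigma (x i ^+ 2)] pulled out of the Pfaffian cancel the diagonal factors in the
    denominator of [F_UO]; the off-diagonal ones form a Vandermonde product by [sigma_mul_eq]. With
    [q = - sigma a ^+ 2], which is 4 or 3 in the two cases, the powers of [sigma a] combine to a
    power of [q], as [2 * n ^ 2] is even. *)
Lemma A2_VO_cauchy (F : fieldType) (n : nat) (x : 'I_(2 * n) -> F) (a q : F)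
    (y b c : nat -> F) (h : 'I_(2 * n) -> 'I_(2 * n) -> F) :
  [pchar F] =i pred0 -> (forall i, x i != 0) -> (forall i, sigma (x i ^+ 2) != 0) ->
  {in gtn (2 * n) &, injective y} -> q != 0 -> sigma a ^+ 2 = - q ->
  (forall i j, M2_UO x a a^-1 i j =
     - sigma a * (sigma (x i ^+ 2) * sigma (x j ^+ 2)) * cauchy_kernel y b c i j) ->
  (forall i j, i != j ->
     sigma (a * x i / x j) * sigma (a * x j / x i) *
     sigma (a * x i * x j) * sigma (a / (x i * x j)) = h i j) ->
  A2_VO n x a = q ^ (- (2 * n%:Z ^+ 2) + n%:Z) *
    ((\prod_(i < 2 * n) \prod_(j < 2 * n | (i < j)%N) h i j) /
     vdm (2 * n) (ext0 (fun i => x i ^+ 2 + (x i ^+ 2)^-1)) *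
     cauchy_pfaffian (2 * n) y b c).
Proof.
move=> F0 x0 s0 yI q0 aq ME hE.
have a0 : sigma a != 0.
  by apply: contra_neq q0 => e; apply/eqP; rewrite -oppr_eq0 -aq e expr0n.
have {}ME i j : M2_UO x a a^-1 i j = - sigma a * (sigma (x i ^+ 2) * sigma (x j ^+ 2)) *
    (\matrix_(i < 2 * n, j < 2 * n) cauchy_kernel y b c i j) i j.
  by rewrite ME mxE.
rewrite /A2_VO (@Pf_scale _ _ _ (fun i => sigma (x i ^+ 2)) _ _ ME).
rewrite Pf_cauchy_kernel //.
have -> : F_UO x a = (\prod_(i < 2 * n) \prod_(j < 2 * n | (i < j)%N) h i j) /
    (vdm (2 * n) (ext0 (fun i => x i ^+ 2 + (x i ^+ 2)^-1)) *
     \prod_i sigma (x i ^+ 2)).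
  congr (_ / _).
    apply: eq_bigr => i _; apply: eq_bigr => j ij; apply: hE.
    by rewrite -val_eqE /= ltn_eqF.
  rewrite -big_split /= -big_split /=; apply: eq_bigr => i _.
  rewrite [X in _ * X](bigD1 i) //= mulrCA mulrC -expr2; congr (_ * _).
  rewrite [X in _ * X](eq_bigl (fun j : 'I__ => (i < j)%N)) => [|j]; last first.
    by rewrite -val_eqE /=; case: ltngtP.
  by rewrite -big_split; apply: eq_bigr => j _; rewrite !ext0E -sigma_mul_eq.
have -> : sigma a ^ (- (4 * n%:Z ^+ 2) + n%:Z) =
    q ^ (- (2 * n%:Z ^+ 2)) * sigma a ^+ n.
  rewrite expfzDr //; congr (_ * _).
  have -> : 4 * n%:Z ^+ 2 = (2 * (2 * n ^ 2))%N%:Z by rewrite !PoszM; ring.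
  have -> : 2 * n%:Z ^+ 2 = (2 * n ^ 2)%N%:Z by rewrite !PoszM; ring.
  by rewrite -!exprnN exprM aq exprM sqrrN -exprM.
rewrite expfzDr // -exprnP.
have -> : q ^+ n = sigma a ^+ n * (- sigma a) ^+ n.
  by rewrite -exprMn mulrN -expr2 aq opprK.
have : \prod_i sigma (x i ^+ 2) != 0 by apply/prodf_neq0.
rewrite invfM; move: (q ^ _) (sigma a ^+ n) ((- sigma a) ^+ n) (\prod_i sigma (x i ^+ 2)).
move: (\prod_i _) (vdm _ _)^-1 (cauchy_pfaffian _ _ _ _) => w d f e1 e2 e3 p p0.
by field.
Qed.

(** Here [a^-1 = - a], so [sigma (a * t)] is [a * (t + t^-1)]. With [u = x * y + (x * y)^-1] and
    [v = y / x + x / y] the bracket is a multiple of [u^-1 - v^-1], while [u * v = X + Y]. *)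
Lemma M2_UO_entry4 (F : fieldType) (x y a : F) :
  2%:R != 0 :> F -> a ^+ 2 = -1 -> x != 0 -> y != 0 ->
  let X := x ^+ 2 + (x ^+ 2)^-1 in
  let Y := y ^+ 2 + (y ^+ 2)^-1 in
  let c := a^-1 in
  Y ^+ 2 - X ^+ 2 != 0 ->
  sigma (y / x) * sigma (x * y) *
    (sigma (c * x) * sigma (c * y) / sigma (a * x * y)
     - sigma (c * x) * sigma (c / y) / sigma (a * x / y)
     - sigma (c / x) * sigma (c * y) / sigma (a * y / x)
     + sigma (c / x) * sigma (c / y) / sigma (a / (x * y))) =
  - sigma a * (sigma (x ^+ 2) * sigma (y ^+ 2)) *
    ((Y - X) * (Y - X) / (Y ^+ 2 - X ^+ 2)).
Proof.
move=> F2 a2 x0 y0 X Y c; rewrite subr_sqr mulf_eq0 negb_or => /andP[YX0 YX].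
have a0 : a != 0 by apply: contra_eq_neq a2 => ->; rewrite expr0n /= eq_sym oppr_eq0 oner_eq0.
have cE : c = - a by rewrite /c; apply: (mulfI a0); rewrite mulrN -expr2 a2 opprK divff.
have aE t : t != 0 -> sigma (a * t) = a * (t + t^-1).
  by move=> t0; rewrite /sigma invfM -/c cE; ring.
have cE' t : t != 0 -> sigma (c * t) = - a * (t + t^-1).
  by move=> t0; rewrite cE mulNr /sigma invrN invfM -/c cE; ring.
have [xV0 yV0] : x^-1 != 0 /\ y^-1 != 0 by rewrite !invr_eq0.
rewrite -!(mulrA a) !cE' // !aE ?invr_eq0 ?mulf_neq0 //.
have -> : sigma a = a + a by rewrite /sigma -/c cE opprK.
have XY : Y + X = (x * y + (x * y)^-1) * (y / x + (y / x)^-1).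
  by rewrite /X /Y; field; rewrite x0 y0.
have Y_X : Y - X = sigma (y / x) * sigma (x * y) by rewrite sigma_mul_eq.
move: YX; rewrite XY mulf_eq0 negb_or => /andP[u0 v0].
have pE t : t^-1 + (t^-1)^-1 = t + t^-1 by rewrite invrK addrC.
have -> : x / y + (x / y)^-1 = y / x + (y / x)^-1 by rewrite -pE invf_div.
rewrite !pE -Y_X.
have -> : sigma (x ^+ 2) * sigma (y ^+ 2) = (x + x^-1) * (y + y^-1) *
    ((x * y + (x * y)^-1) - (y / x + (y / x)^-1)).
  by rewrite /sigma; field; rewrite x0 y0.
move: (x + x^-1) (y + y^-1) (x * y + _) (y / x + _) (Y - X) u0 v0 YX0.
by move=> p q u v d u0 v0 d0; field; rewrite u0 v0 d0 a0.
Qed.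

(** The relations [c = 1 - a], [c * c = - a] and [a * a = - c] reduce the products to linear
    expressions in [a] and [c]. The last factor on the right is invariant under inverting [y], so
    the lemma serves both pairs of fractions in an entry. *)
Lemma M2_UO_num6 (F : fieldType) (x y a : F) :
  a ^+ 2 - a + 1 = 0 -> x != 0 -> y != 0 ->
  let c := a^-1 in
  sigma (c * x) * sigma (c * y) * sigma (a / (x * y)) +
  sigma (c / x) * sigma (c / y) * sigma (a * x * y) =
  - sigma a * (2%:R + (x / y + y / x) * (x * y + (x * y)^-1)).
Proof.
move=> a2 x0 y0 c.
have a0 : a != 0.
  by apply: contra_eq_neq a2 => ->; rewrite expr0n /= subr0 add0r oner_eq0.
have ac : a * c = 1 by rewrite divff.
have cE : c = 1 - a.
  apply: (mulfI a0); rewrite ac; apply/eqP; rewrite -subr_eq0 -a2; apply/eqP; ring.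
have cc : c * c = - a by rewrite {2}cE mulrBr mulr1 mulrC ac cE; ring.
have aa : a * a = - c by rewrite cE; apply/eqP; rewrite -subr_eq0 -a2; apply/eqP; ring.
have sa t : sigma (a * t) = a * t - c * t^-1 by rewrite /sigma invfM.
have sc t : sigma (c * t) = c * t - a * t^-1 by rewrite /sigma invfM invrK.
rewrite -(mulrA a) !sa !sc /sigma -/c !invfM !invrK.
move: x^-1 y^-1 (mulfV x0) (mulfV y0) => u v xu yv.
have e1 (p q r s : F) : (c * p - a * q) * (c * r - a * s) =
    (c * c) * (p * r) - (a * c) * (p * s + q * r) + (a * a) * (q * s) by ring.
have e2 (w w' r : F) : (- a * w - 1 * r + - c * w') * (a * w' - c * w) =
    ((c * c) - (a * a)) * (w * w') + (a * c) * (w * w - w' * w') + r * (c * w - a * w').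
  by ring.
have uv1 : x * y * (u * v) = 1 by rewrite mulrACA xu yv mulr1.
rewrite !e1 cc aa ac !e2 cc aa ac [u * v * (x * y)]mulrC uv1.
ring.
Qed.

Lemma sigma_mul6 (F : fieldType) (a t : F) :
  a ^+ 2 - a + 1 = 0 -> t != 0 ->
  sigma (a * t) * sigma (a / t) = - (t ^+ 2 + 1 + (t ^+ 2)^-1).
Proof.
move=> a2 t0.
have a0 : a != 0.
  by apply: contra_eq_neq a2 => ->; rewrite expr0n /= subr0 add0r oner_eq0.
have e : sigma (a * t) * sigma (a / t) =
    (a - a^-1) ^+ 2 + 2%:R - (t ^+ 2 + (t ^+ 2)^-1).
  by rewrite /sigma; field; rewrite a0 t0.
have e2 : (a - a^-1) ^+ 2 = - 3%:R.
  apply/eqP; rewrite -subr_eq0 opprK.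
  have -> : (a - a^-1) ^+ 2 + 3%:R = (a ^+ 2 - a + 1) * (a ^+ 2 + a + 1) / a ^+ 2.
    by field.
  by rewrite a2 !mul0r.
by rewrite e e2; ring.
Qed.

(** The fractions are paired so that the denominators multiply to [- P] and [- Q]. Both combined
    numerators are [- sigma a * T], so the bracket is a multiple of [P^-1 - Q^-1], and [P - Q] is
    the product of the row and column factors. *)
Lemma M2_UO_entry6 (F : fieldType) (x y a : F) :
  a ^+ 2 - a + 1 = 0 -> x != 0 -> y != 0 ->
  let X := x ^+ 2 + (x ^+ 2)^-1 in
  let Y := y ^+ 2 + (y ^+ 2)^-1 in
  let c := a^-1 in
  (Y ^+ 3 - 3%:R * Y) - (X ^+ 3 - 3%:R * X) != 0 ->
  sigma (y / x) * sigma (x * y) *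
    (sigma (c * x) * sigma (c * y) / sigma (a * x * y)
     - sigma (c * x) * sigma (c / y) / sigma (a * x / y)
     - sigma (c / x) * sigma (c * y) / sigma (a * y / x)
     + sigma (c / x) * sigma (c / y) / sigma (a / (x * y))) =
  - sigma a * (sigma (x ^+ 2) * sigma (y ^+ 2)) *
    ((Y - X) * ((Y + 1) ^+ 2 - (X + 1) ^+ 2) /
     ((Y ^+ 3 - 3%:R * Y) - (X ^+ 3 - 3%:R * X))).
Proof.
move=> a2 x0 y0 X Y c.
pose P := (x * y) ^+ 2 + 1 + ((x * y) ^+ 2)^-1.
pose Q := (y / x) ^+ 2 + 1 + ((y / x) ^+ 2)^-1.
have -> : (Y ^+ 3 - 3%:R * Y) - (X ^+ 3 - 3%:R * X) = (Y - X) * (P * Q).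
  by rewrite /X /Y /P /Q; field; rewrite x0 y0.
rewrite !mulf_eq0 !negb_or => /and3P[YX0 P0 Q0].
have PE : sigma (a * x * y) * sigma (a / (x * y)) = - P.
  by rewrite -mulrA sigma_mul6 ?mulf_neq0.
have QE : sigma (a * y / x) * sigma (a * x / y) = - Q.
  rewrite -(mulrA a y) -(mulrA a x) -(invf_div y x) sigma_mul6 //.
  by rewrite mulf_neq0 ?invr_eq0.
(* This is [X + Y + 2], the quotient of [(Y + 1) ^+ 2 - (X + 1) ^+ 2] by [Y - X]. *)
pose T := 2%:R + (x / y + y / x) * (x * y + (x * y)^-1).
have N1 : sigma (c * x) * sigma (c * y) * sigma (a / (x * y)) +
    sigma (c / x) * sigma (c / y) * sigma (a * x * y) = - sigma a * T.
  exact: M2_UO_num6.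
have N2 : sigma (c * x) * sigma (c / y) * sigma (a * y / x) +
    sigma (c / x) * sigma (c * y) * sigma (a * x / y) = - sigma a * T.
  have yV0 : y^-1 != 0 by rewrite invr_eq0.
  have := M2_UO_num6 a2 x0 yV0; rewrite /= -/c !invrK -(mulrA a y) invf_div => ->.
  by congr (_ * _); rewrite /T; field; rewrite x0 y0.
rewrite -sigma_mul_eq // in YX0 *.
have -> : sigma (x ^+ 2) * sigma (y ^+ 2) = P - Q.
  by rewrite /P /Q /sigma; field; rewrite x0 y0.
have -> : (Y + 1) ^+ 2 - (X + 1) ^+ 2 = (Y - X) * T.
  by rewrite /X /Y /T; field; rewrite x0 y0.
rewrite -sigma_mul_eq //; move: YX0 P0 Q0 PE QE N1 N2.
move: (sigma (y / x) * _) (sigma (a * x * y)) (sigma (a / (x * y))) (sigma (a * x / y))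
  (sigma (a * y / x)) (sigma (c * x)) (sigma (c * y)) (sigma (c / x)) (sigma (c / y)).
move=> d sA sD sB sC cx cy cx' cy' d0 P0 Q0 PE QE N1 N2.
have /andP[A0 D0] : (sA != 0) && (sD != 0).
  by rewrite -negb_or -mulf_eq0 PE oppr_eq0.
have /andP[C0 B0] : (sC != 0) && (sB != 0).
  by rewrite -negb_or -mulf_eq0 QE oppr_eq0.
have -> : cx * cy / sA - cx * cy' / sB - cx' * cy / sC + cx' * cy' / sD =
    (cx * cy * sD + cx' * cy' * sA) / (sA * sD) -
    (cx * cy' * sC + cx' * cy * sB) / (sC * sB) by field; rewrite A0 B0 C0 D0.
by rewrite N1 N2 PE QE; field; rewrite !oppr_eq0 d0 P0 Q0.
Qed.

(** * The two specializations over a field of characteristic 0 *)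

Lemma vdm_sqr (R : comNzRingType) (N : nat) (z : nat -> R) :
  vdm N (fun i => z i ^+ 2) =
  vdm N z * \prod_(i < N) \prod_(j < N | (i < j)%N) (z i + z j).
Proof.
rewrite /vdm -big_split /=; apply: eq_bigr => i _; rewrite -big_split /=.
by apply: eq_bigr => j _; rewrite subr_sqr (addrC (z i)).
Qed.

Lemma det_interlaced_sqr (R : comNzRingType) (N : nat) (z : nat -> R) :
  \det (interlaced N (fun i => z i ^+ 2) z) = vdm N z.
Proof.
rewrite vdmE; congr (\det _); apply/matrixP => i j; rewrite !mxE.
by rewrite -exprM -exprD mul2n addnC odd_double_half.
Qed.

(** With [y = z ^+ 2] both interlaced determinants are Vandermonde in [z], and the Vandermonde
    product of [y] contributes one factor [z i + z j] per pair to the denominator. The numerator of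
    [F_UO] has the square of that factor, so one copy survives. *)
Lemma A2_VO_zeta4 (F : fieldType) (n : nat) (x : 'I_(2 * n) -> F) (a : F) :
  [pchar F] =i pred0 -> (forall i, x i != 0) -> (forall i, sigma (x i ^+ 2) != 0) ->
  injective (fun i => (x i ^+ 2 + (x i ^+ 2)^-1) ^+ 2) -> a ^+ 2 = -1 ->
  A2_VO n x a = 4%:R ^ (- (2 * n%:Z ^+ 2) + n%:Z) *
    \prod_(i < 2 * n) \prod_(j < 2 * n | (i < j)%N)
      ((x i ^+ 2 + (x i ^+ 2)^-1) + (x j ^+ 2 + (x j ^+ 2)^-1)).
Proof.
move=> F0 x0 s0 zI a2; set v := fun i => x i ^+ 2 + (x i ^+ 2)^-1.
pose z := ext0 v.
have nat0 m : (0 < m)%N -> m%:R != 0 :> F.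
  by move=> m0; rewrite ((pcharf0P F).1 F0) -lt0n.
have a0 : a != 0.
  by apply: contra_eq_neq a2 => ->; rewrite expr0n /= eq_sym oppr_eq0 oner_eq0.
have aV : a^-1 = - a by apply: (mulfI a0); rewrite mulrN -expr2 a2 opprK divff.
have zI2 : {in gtn (2 * n) &, injective (fun i => z i ^+ 2)}.
  move=> i j iN jN; rewrite /z (ext0E v (Ordinal iN)) (ext0E v (Ordinal jN)).
  by move=> /zI[].
have dz (i j : 'I_(2 * n)) : i != j -> v j ^+ 2 - v i ^+ 2 != 0.
  by rewrite subr_eq0 eq_sym; apply: contra_neq; apply: zI.
rewrite (@A2_VO_cauchy _ _ _ _ 4%:R (fun i => z i ^+ 2) z z
  (fun i j => (v i + v j) ^+ 2)) ?nat0 //; last first.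
- move=> i j ij.
  have aE t : t != 0 -> sigma (a * t) = a * (t + t^-1).
    by move=> t0; rewrite /sigma invfM aV; ring.
  have [xV0 yV0] : (x i)^-1 != 0 /\ (x j)^-1 != 0 by rewrite !invr_eq0.
  rewrite -!(mulrA a) !aE ?invr_eq0 ?mulf_neq0 //.
  have a4 : a ^+ 4 = 1 by rewrite (exprM a 2 2) a2 sqrrN expr1n.
  rewrite -[RHS]mul1r -a4 /v.
  by field; rewrite !x0 ?oner_neq0.
- move=> i j; rewrite mxE /cauchy_kernel /z !ext0E.
  (* On the diagonal both sides are 0: [sigma 1 = 0], and the kernel has numerator 0. *)
  have [->|ij] := eqVneq i j.
    by rewrite divff // /sigma invr1 !subrr !mul0r mulr0.
  by apply: M2_UO_entry4; rewrite ?nat0 // dz.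
- rewrite /sigma aV opprK (_ : (a + a) ^+ 2 = a ^+ 2 * 4%:R); last by ring.
  by rewrite a2 mulN1r.
rewrite /cauchy_pfaffian !det_interlaced_sqr vdm_sqr.
have V0 : vdm (2 * n) z != 0.
  by apply: vdm_neq0 => i j iN jN e; apply: zI2; rewrite ?e.
have -> : \prod_(i < 2 * n) \prod_(j < 2 * n | (i < j)%N) (v i + v j) ^+ 2 =
    (\prod_(i < 2 * n) \prod_(j < 2 * n | (i < j)%N) (v i + v j)) ^+ 2.
  by rewrite -prodrXl; apply: eq_bigr => i _; rewrite -prodrXl.
rewrite -/z.
have -> : \prod_(i < 2 * n) \prod_(j < 2 * n | (i < j)%N) (z i + z j) =
    \prod_(i < 2 * n) \prod_(j < 2 * n | (i < j)%N) (v i + v j).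
  by apply: eq_bigr => i _; apply: eq_bigr => j _; rewrite /z !ext0E.
have : \prod_(i < 2 * n) \prod_(j < 2 * n | (i < j)%N) (v i + v j) != 0.
  apply/prodf_neq0 => i _; apply/prodf_neq0 => j ij.
  have /dz : i != j by rewrite -val_eqE /= ltn_eqF.
  by rewrite subr_sqr mulf_eq0 negb_or [v j + v i]addrC => /andP[].
move: (\prod_i _) (vdm _ _) V0 => p d d0 p0.
by congr (_ * _); field; rewrite ?d0 ?p0.
Qed.

(** The numerator of [F_UO] is the Vandermonde product of [y] over that of [z]; its first part
    cancels the denominator of the closed Pfaffian, and two Vandermonde products of [z] remain, one
    for each symplectic character. *)
Lemma A2_VO_zeta6 (F : fieldType) (n : nat) (x : 'I_(2 * n) -> F) (a : F) :
  let z := ext0 (fun i => x i ^+ 2 + (x i ^+ 2)^-1) in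
  let y i := z i ^+ 3 - 3%:R * z i in
  [pchar F] =i pred0 -> (forall i, x i != 0) -> (forall i, sigma (x i ^+ 2) != 0) ->
  {in gtn (2 * n) &, injective y} -> a ^+ 2 - a + 1 = 0 ->
  A2_VO n x a * vdm (2 * n) z ^+ 2 = 3%:R ^ (- (2 * n%:Z ^+ 2) + n%:Z) *
    (\det (interlaced (2 * n) y z) *
     \det (interlaced (2 * n) y (fun i => (z i + 1) ^+ 2))).
Proof.
move=> z y F0 x0 s0 yI a2.
have nat0 m : (0 < m)%N -> m%:R != 0 :> F.
  by move=> m0; rewrite ((pcharf0P F).1 F0) -lt0n.
have a0 : a != 0.
  by apply: contra_eq_neq a2 => ->; rewrite expr0n /= subr0 add0r oner_eq0.
have dy (i j : 'I_(2 * n)) : i != j -> y j - y i != 0.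
  move=> ij; rewrite subr_eq0 eq_sym; apply: contra_neq ij => /yI e.
  by apply: val_inj; apply: e; rewrite inE.
have V0 : vdm (2 * n) z != 0.
  by apply: vdm_neq0 => i j iN jN e; apply: yI; rewrite // /y e.
have W0 : vdm (2 * n) y != 0 by apply: vdm_neq0.
rewrite (@A2_VO_cauchy _ _ _ _ 3%:R y z (fun i => (z i + 1) ^+ 2)
  (fun i j => (y j - y i) / (z j - z i))) ?nat0 //; last first.
- move=> i j /dy; rewrite /y /z !ext0E => dij.
  have -> : sigma (a * x i / x j) * sigma (a * x j / x i) * sigma (a * x i * x j) *
      sigma (a / (x i * x j)) = (sigma (a * (x j / x i)) * sigma (a / (x j / x i))) *
      (sigma (a * (x i * x j)) * sigma (a / (x i * x j))).
    by rewrite invf_div !mulrA [X in X * _ * _ = _]mulrC.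
  rewrite !sigma_mul6 ?mulf_neq0 ?invr_eq0 //.
  have d0 : x j ^+ 2 + (x j ^+ 2)^-1 - (x i ^+ 2 + (x i ^+ 2)^-1) != 0.
    by apply: contra_neq dij => /subr0_eq ->; rewrite subrr.
  apply: (mulIf d0); rewrite divfK //.
  by field; rewrite !x0 ?oner_neq0.
- move=> i j; rewrite mxE /cauchy_kernel /y /z !ext0E.
  have [->|ij] := eqVneq i j.
    by rewrite divff // /sigma invr1 !subrr !mul0r mulr0.
  by apply: M2_UO_entry6 => //; have := dy _ _ ij; rewrite /y /z !ext0E.
- have -> : sigma a ^+ 2 = - 3%:R + (a ^+ 2 - a + 1) * (a ^+ 2 + a + 1) / a ^+ 2.
    by rewrite /sigma; field.
  by rewrite a2 !mul0r addr0.
rewrite -/z /cauchy_pfaffian.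
have -> : \prod_(i < 2 * n) \prod_(j < 2 * n | (i < j)%N) ((y j - y i) / (z j - z i)) =
    vdm (2 * n) y / vdm (2 * n) z.
  by rewrite -prodf_div; apply: eq_bigr => i _; rewrite prodf_div.
rewrite -[LHS]mulrA; congr (_ * _); move: (vdm _ z) (vdm _ y) V0 W0 => d w d0 w0.
by field; rewrite d0 w0.
Qed.

Lemma Sp_half (N : nat) (F : fieldType) (v : 'I_N -> F) :
  let z := ext0 (fun i => v i + (v i)^-1) in
  (forall i, v i != 0) ->
  Sp N (rev (mkseq half N)) v * vdm N z =
  \det (interlaced N (fun i => z i ^+ 3 - 3%:R * z i) z).
Proof.
move=> z v0; rewrite Sp_vdm // -det_chebyshev_half; congr (\det _).
by apply/matrixP => i j; rewrite !mxE nth_rev_half // addnC /z ext0E.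
Qed.

(** The extra variable adds the factors [2 - z i] to the Vandermonde product. They match the factors
    [z i - 2] of [det_interlaced_last2], as [N] is even, and can be cancelled because
    [z i - 2 = (v i - 1) ^+ 2 / v i] is nonzero. *)
Lemma Sp_half_one (N : nat) (F : fieldType) (v : 'I_N -> F) :
  let z := ext0 (fun i => v i + (v i)^-1) in
  ~~ odd N -> (forall i, v i != 0) -> (forall i, v i != 1) ->
  Sp N.+1 (rev (mkseq half N.+1)) (rcons_fun v 1) * vdm N z =
  \det (interlaced N (fun i => z i ^+ 3 - 3%:R * z i) (fun i => (z i + 1) ^+ 2)).
Proof.
move=> z oddN v0 v1; pose v' := rcons_fun v 1.
have v'E (i : 'I_N) : v' (lift ord_max i) = v i by rewrite /v' /rcons_fun liftK.
have v'N : v' ord_max = 1 by rewrite /v' /rcons_fun unlift_none.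
have v'0 i : v' i != 0.
  by case: (unliftP ord_max i) => [j|] ->; rewrite ?v'E ?v'N ?oner_neq0.
pose z' := ext0 (fun i => v' i + (v' i)^-1).
have z'E (i : 'I_N) : z' i = z i.
  by rewrite -[i in z' i](lift_max i) /z' /z !ext0E v'E.
have z'N : z' N = 2%:R.
  by rewrite -[N in z' N]/(val (@ord_max N)) /z' ext0E v'N invr1.
have P0 : \prod_(i < N) (z' i - 2%:R) != 0.
  apply/prodf_neq0 => i _; rewrite z'E /z ext0E.
  have -> : v i + (v i)^-1 - 2%:R = (v i - 1) ^+ 2 / v i by field.
  by rewrite mulf_neq0 ?invr_eq0 // expf_neq0 // subr_eq0.
apply: (mulfI P0).
have -> : \det (interlaced N (fun i => z i ^+ 3 - 3%:R * z i) (fun i => (z i + 1) ^+ 2)) =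
    \det (interlaced N (fun i => z' i ^+ 3 - 3%:R * z' i) (fun i => (z' i + 1) ^+ 2)).
  by congr (\det _); apply/matrixP => i j; rewrite !mxE !z'E.
rewrite -det_interlaced_last2 // -(Sp_half v'0) -/z' vdm_recr mulrCA; congr (_ * _).
rewrite mulrC; congr (_ * _).
  by apply: eq_bigr => i _; apply: eq_bigr => j _; rewrite !z'E.
rewrite [RHS](eq_bigr (fun i : 'I_N => -1 * (z' i - 2%:R))) => [|i _].
  by rewrite big_split /= prodr_const card_ord -signr_odd (negPf oddN) mul1r.
by rewrite z'N mulN1r opprB.
Qed.

(** * The roots of unity, generic variables and the conclusion *)

Lemma ratfun_pchar0 (R : realType) (N : nat) : [pchar ratfun R N] =i pred0.
Proof.
apply/(pcharf0P (ratfun R N)) => m.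
by rewrite -(rmorph_nat (@tofrac {mpoly R[i][N]})) tofrac_eq0 -mpolyC_nat
  mpolyC_eq0 pnatr_eq0.
Qed.

Lemma zeta4_sqr (R : realType) : zeta R 4 ^+ 2 = -1.
Proof.
have -> : zeta R 4 = 'i%C.
  rewrite /zeta (_ : 2%:R * pi / 4%:R = pi / 2%:R); last by field.
  by rewrite cos_pihalf sin_pihalf.
by rewrite sqr_i.
Qed.

Lemma zeta6_minpoly (R : realType) : zeta R 6 ^+ 2 - zeta R 6 + 1 = 0.
Proof.
rewrite /zeta; set t := 2%:R * pi / 6%:R.
have t3 : 3%:R * t = pi by rewrite /t; field.
have c3 : cos t ^+ 3 *+ 4 - cos t *+ 3 = -1 :> R.
  rewrite -cospi -t3 (_ : 3%:R * t = t + t + t); last by ring.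
  rewrite !cosD sinD; have -> : cos t ^+ 3 *+ 4 - cos t *+ 3 =
      cos t ^+ 3 *+ 4 - cos t * (cos t ^+ 2 + sin t ^+ 2) *+ 3.
    by rewrite cos2Dsin2 mulr1.
  ring.
have c0 : 0 < cos t.
  apply: cos_gt0_pihalf; have := pi_gt0 R => p0.
  by apply/andP; split; lra.
have c2 : cos t = 2%:R^-1.
  have : (cos t + 1) * (cos t *+ 2 - 1) ^+ 2 = 0.
    by rewrite -[RHS](addNr (1 : R)) -[X in _ = X + _]c3; ring.
  move/eqP; rewrite mulf_eq0 expf_eq0 /= gt_eqF /=; last by lra.
  by move=> /eqP ?; lra.
have s2 : sin t ^+ 2 = 3%:R / 4%:R.
  have := cos2Dsin2 t; rewrite c2 => /(canRL (addKr _)) ->; by field.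
rewrite c2; apply/eqP; rewrite eq_complex /=; apply/andP; split; apply/eqP.
  by rewrite -(expr2 (sin t)) s2; field.
by field.
Qed.

Lemma prod_sum_inv (F : fieldType) (n : nat) (x : 'I_(2 * n.+1) -> F) :
  (forall i, x i != 0) ->
  \prod_(i < 2 * n.+1) \prod_(j < 2 * n.+1 | (i < j)%N)
    ((x i ^+ 2 + (x i ^+ 2)^-1) + (x j ^+ 2 + (x j ^+ 2)^-1)) =
  \prod_(i < 2 * n.+1) x i ^ (- (4 * n.+1%:Z) + 2) *
  \prod_(i < 2 * n.+1) \prod_(j < 2 * n.+1 | (i < j)%N)
    ((x j ^+ 2 + x i ^+ 2) * (1 + x i ^+ 2 * x j ^+ 2)).
Proof.
move=> x0.
(* Each index lies in [(2 * n.+1).-1] pairs, and every pair contributes [x i ^- 2 * x j ^- 2]. *)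
rewrite [X in _ = X * _](eq_bigr (fun i => (x i ^- 2) ^+ (2 * n.+1).-1)) => [|i _]; last first.
  rewrite -exprVn -exprM exprVn exprnN; congr (_ ^ _); lia.
rewrite -prod_pairs -big_split /=; apply: eq_bigr => i _; rewrite -big_split /=.
by apply: eq_bigr => j _; field; rewrite !x0.
Qed.

Lemma A2_VO_zeta4_prod (F : fieldType) (n : nat) (x : 'I_(2 * n.+1) -> F) (a : F) :
  [pchar F] =i pred0 -> (forall i, x i != 0) -> (forall i, sigma (x i ^+ 2) != 0) ->
  injective (fun i => x i ^+ 4 + (x i ^+ 4)^-1) -> a ^+ 2 = -1 ->
  A2_VO n.+1 x a =
    2%:R ^ (- (4 * n.+1%:Z ^+ 2) + 2 * n.+1%:Z) *
    \prod_(i < 2 * n.+1) x i ^ (- (4 * n.+1%:Z) + 2) *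
    \prod_(i < 2 * n.+1) \prod_(j < 2 * n.+1 | (i < j)%N)
       ((x j ^+ 2 + x i ^+ 2) * (1 + x i ^+ 2 * x j ^+ 2)).
Proof.
move=> F0 x0 s0 zI a2; rewrite A2_VO_zeta4 //.
  rewrite prod_sum_inv // mulrA; congr (_ * _ * _).
  have -> : 4%:R = 2%:R ^ 2 :> F by rewrite -exprnP -natrX.
  by rewrite exprz_exp; congr (_ ^ _); ring.
have sqrE (t : F) : t != 0 -> (t ^+ 2 + (t ^+ 2)^-1) ^+ 2 = t ^+ 4 + (t ^+ 4)^-1 + 2%:R.
  by move=> t0; field.
by move=> i j /=; rewrite !sqrE // => /addIr/zI.
Qed.

Lemma A2_VO_zeta6_Sp (F : fieldType) (n : nat) (x : 'I_(2 * n.+1) -> F) (a : F) :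
  [pchar F] =i pred0 -> (forall i, x i != 0) -> (forall i, sigma (x i ^+ 2) != 0) ->
  (forall i, x i ^+ 2 != 1) -> injective (fun i => x i ^+ 6 + (x i ^+ 6)^-1) ->
  a ^+ 2 - a + 1 = 0 ->
  A2_VO n.+1 x a =
    3%:R ^ (- (2 * n.+1%:Z ^+ 2) + n.+1%:Z) *
    Sp (2 * n.+1) (delta2 (n.+1%:Z - 1) (n.+1%:Z - 1)) (fun i => x i ^+ 2) *
    Sp (2 * n.+1).+1 (delta2 n.+1%:Z (n.+1%:Z - 1)) (rcons_fun (fun i => x i ^+ 2) 1).
Proof.
move=> F0 x0 s0 x1 yI a2.
have x20 i : x i ^+ 2 != 0 by rewrite expf_neq0.
pose z := ext0 (fun i => x i ^+ 2 + (x i ^+ 2)^-1).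
have cubeE (t : F) : t != 0 -> (t ^+ 2 + (t ^+ 2)^-1) ^+ 3 -
    3%:R * (t ^+ 2 + (t ^+ 2)^-1) = t ^+ 6 + (t ^+ 6)^-1 by move=> t0; field.
have yI' : {in gtn (2 * n.+1) &, injective (fun i => z i ^+ 3 - 3%:R * z i)}.
  move=> i j iN jN; rewrite /z !(ext0E _ (Ordinal iN)) !(ext0E _ (Ordinal jN)).
  by rewrite !cubeE // => /yI[].
have V0 : vdm (2 * n.+1) z != 0.
  by apply: vdm_neq0 => i j iN jN e; apply: yI'; rewrite // e.
apply: (mulIf (expf_neq0 2 V0)); rewrite A2_VO_zeta6 // delta2_even delta2_odd.
rewrite -(Sp_half x20) -(Sp_half_one _ x20 x1) ?oddM //.
move: (Sp _ _ _) (Sp _ _ _) (_ ^ _) => f g e.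
by rewrite -/z; ring.
Qed.

Theorem theorem2p4 (R : realType) (n : nat) (hn : (1 <= n)%N) :
  let x : 'I_(2 * n) -> ratfun R (2 * n) := fun i => ratX R i in
  A2_VO n x (ratC (2 * n) (zeta R 4)) =
    2%:R ^ (- (4 * n%:Z ^+ 2) + 2 * n%:Z) *
    \prod_(i < 2 * n) x i ^ (- (4 * n%:Z) + 2) *
    \prod_(i < 2 * n) \prod_(j < 2 * n | (i < j)%N)
       ((x j ^+ 2 + x i ^+ 2) * (1 + x i ^+ 2 * x j ^+ 2))
  /\
  A2_VO n x (ratC (2 * n) (zeta R 6)) =
    3%:R ^ (- (2 * n%:Z ^+ 2) + n%:Z) *
    Sp (2 * n) (delta2 (n%:Z - 1) (n%:Z - 1)) (fun i => x i ^+ 2) *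
    Sp (2 * n).+1 (delta2 n%:Z (n%:Z - 1)) (rcons_fun (fun i => x i ^+ 2) 1).
Proof.
(* Writing [n] as a successor makes [n - 1] a natural number, as the evaluation of [delta2]
   requires. *)
case: n hn => // n _ x.
have F0 := @ratfun_pchar0 R (2 * n.+1).
have x0 i : x i != 0 by apply: tofrac_X_neq0.
have x20 i : x i ^+ 2 != 0 by rewrite expf_neq0.
have s0 i : sigma (x i ^+ 2) != 0.
  by rewrite sigma_neq0 // -exprM tofrac_exp_neq1.
split.
  apply: A2_VO_zeta4_prod => //; first exact: (@tofrac_add_inv_inj _ _ 4).
  by rewrite /ratC -!rmorphXn zeta4_sqr !rmorphN1.
have rmorph6 (S T : nzRingType) (f : {rmorphism S -> T}) (a : S) :
    a ^+ 2 - a + 1 = 0 -> f a ^+ 2 - f a + 1 = 0.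
  by move=> a0; rewrite -rmorphXn -rmorphB -(rmorph1 f) -rmorphD a0 rmorph0.
apply: (A2_VO_zeta6_Sp F0 x0 s0).
- by move=> i; apply: tofrac_exp_neq1.
- exact: (@tofrac_add_inv_inj _ _ 6).
exact: (rmorph6 _ _ _ _ (rmorph6 _ _ _ _ (zeta6_minpoly R))).
Qed.
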